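(* Let $n \geq 0$ be an integer and let $R$ be a Gorenstein $n$-coherent ring. If $\mathrm{fd}(\mathcal{FP}_n\text{-}\mathrm{Inj}(R)) = \mathrm{fd}(\mathcal{FP}_n\text{-}\mathrm{Inj}(R^{\mathrm{op}}))$, then $$\mathrm{l.w.Ggl}_{\mathcal{FP}_n\text{-}\mathrm{Inj}(R^{\mathrm{op}})}(R) = \mathrm{r.w.Ggl}_{\mathcal{FP}_n\text{-}\mathrm{Inj}(R)}(R^{\mathrm{op}}).$$
   Context: $R$ is an associative ring with identity; $\mathrm{Mod}(R)$ is the category of left $R$-modules, $\mathrm{Mod}(R^{\mathrm{op}})$ that of right $R$-modules. For a class $\mathcal{X}$ of modules, $\mathrm{fd}(\mathcal{X}) := \sup\{\mathrm{fd}(X) : X \in \mathcal{X}\}$, where $\mathrm{fd}$ is flat dimension. A left $R$-module $M$ is finitely $n$-presented if there is an exact sequence $P_n \to \cdots \to P_1 \to P_0 \to M \to 0$ with each $P_i$ finitely generated free; $\mathcal{FP}_n(R)$ is the class of these. A left $R$-module $E$ is $\mathcal{FP}_n$-injective if $\mathrm{Ext}^1_R(M,E)=0$ for all $M \in \mathcal{FP}_n(R)$; the class of these is $\mathcal{FP}_n\text{-}\mathrm{Inj}(R)$. The classes $\mathcal{FP}_n(R^{\mathrm{op}})$ and $\mathcal{FP}_n\text{-}\mathrm{Inj}(R^{\mathrm{op}})$ are the analogous classes of right $R$-modules. $R$ is left $n$-coherent if $\mathcal{FP}_n(R) \subseteq \mathcal{FP}_{n+1}(R)$; right $n$-coherent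 is defined analogously with $R^{\mathrm{op}}$. $R$ is Gorenstein $n$-coherent if it is left and right $n$-coherent and there is an integer $m \geq 0$ such that $\mathrm{fd}(M) \leq m$ and $\mathrm{fd}(N) \leq m$ for all $M \in \mathcal{FP}_n\text{-}\mathrm{Inj}(R)$ and $N \in \mathcal{FP}_n\text{-}\mathrm{Inj}(R^{\mathrm{op}})$. For a class $\mathcal{B}$ of right $R$-modules, $\mathcal{GF}_{\mathcal{B}}$ is the class of left $R$-modules $G \cong \mathrm{Ker}(F^0 \to F^1)$ for some exact complex $\cdots \to F_1 \to F_0 \to F^0 \to F^1 \to \cdots$ of flat left $R$-modules which remains exact after applying $B \otimes_R -$ for every $B \in \mathcal{B}$. $\mathrm{Gfd}_{\mathcal{B}}(M)$ is the least $k \geq 0$ for which there is an exact sequence $0 \to G_k \to \cdots \to G_0 \to M \to 0$ with all $G_i \in \mathcal{GF}_{\mathcal{B}}$ ($\infty$ if none exists), and $\mathrm{l.w.Ggl}_{\mathcal{B}}(R) := \sup\{\mathrm{Gfd}_{\mathcal{B}}(M) : M \in \mathrm{Mod}(R)\}$. For a class $\mathcal{B}'$ of left $R$-modules, $\mathrm{r.w.Ggl}_{\mathcal{B}'}(R^{\mathrm{op}})$ is defined symmetrically, as the supremum over right $R$-modules of the resolution dimension with respect to the class $\mathcal{GF}_{\mathcal{B}'}$ of right $R$-modules (kernels in exact complexes of flat right $R$-modules that remain exact under $-\otimes_R B'$ for all $B'\in\mathcal{B}'$). *)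

(* Defs.v *)
(* Left R-modules are [lmodType R]; right R-modules are left modules over the
   converse ring [R^c], with right action [b . r = (r : R^c) *: b].
   [pzRingType] is the structure of all associative unital rings, the zero ring
   included. *)
From HB Require Import structures.
From mathcomp Require Import all_boot all_algebra.
From mathcomp Require Import boolp freeg.

Set Implicit Arguments.
Unset Strict Implicit.
Unset Printing Implicit Defensive.

Import GRing.Theory.
Local Open Scope ring_scope.
Local Open Scope quotient_scope.

(* [Some k] is the integer k, [None] is infinity. *)
Definition enat := option nat.

Definition enat_le (x : enat) (m : nat) : Prop :=
  if x is Some k then (k <= m)%N else False.

Definition least (P : nat -> Prop) : enat :=
  if pselect (exists k, `[< P k >]) is left h then Some (ex_minn h) else None.

(* The supremum of [{f x | X x}]: the least finite upper bound, if any. *)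
Definition esup (T : Type) (X : T -> Prop) (f : T -> enat) : enat :=
  least (fun m => forall x, X x -> enat_le (f x) m).

Section TensorDef.
Variables (R : pzRingType) (B : lmodType R^c) (F : lmodType R).

Definition free_pure (b : B) (x : F) : {freeg (B * F)%type} := << (b, x) >>.

(* The subgroup of the free abelian group on B * F generated by the
   bilinearity and balancing relations. *)
Inductive tensor_rel : {freeg (B * F)%type} -> Prop :=
| TensorRel0 : tensor_rel 0
| TensorRelB u v : tensor_rel u -> tensor_rel v -> tensor_rel (u - v)
| TensorRelDl b b' x :
    tensor_rel (free_pure (b + b') x - (free_pure b x + free_pure b' x))
| TensorRelDr b x x' :
    tensor_rel (free_pure b (x + x') - (free_pure b x + free_pure b x'))
| TensorRelZ b (r : R) x :
    tensor_rel (free_pure ((r : R^c) *: b) x - free_pure b (r *: x)).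

Definition tensor_pred : {pred {freeg (B * F)%type}} :=
  fun u => `[< tensor_rel u >].

Fact tensor_pred_closed : zmod_closed tensor_pred.
Proof.
split; first by apply/asboolP; exact: TensorRel0.
by move=> u v /asboolP hu /asboolP hv; apply/asboolP; exact: TensorRelB.
Qed.

HB.instance Definition _ :=
  GRing.isZmodClosed.Build {freeg (B * F)%type} tensor_pred tensor_pred_closed.

Definition tensor : zmodType := Quotient.quot tensor_pred.

Definition tens (b : B) (x : F) : tensor :=
  \pi_(Quotient.quot tensor_pred) (free_pure b x).

End TensorDef.

Arguments tensor_pred [R] B F _.

(* The map [g (x) f], computed on a representative; independence of the
   representative is [tensor_map_pi]. *)
Section TensorMap.
Variables (R : pzRingType) (B B' : lmodType R^c) (F F' : lmodType R).
Variables (g : {linear B -> B'}) (f : {linear F -> F'}).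

Let pre : {freeg (B * F)%type} -> {freeg (B' * F')%type} :=
  fglift (fun p => << (g p.1, f p.2) >>).

Definition tensor_map (t : tensor B F) : tensor B' F' :=
  \pi_(Quotient.quot (tensor_pred B' F'))
     (pre (repr (t : Quotient.quot (tensor_pred B F)))).

Let preB : {morph pre : u v / u - v}.
Proof. exact: lift_is_additive. Qed.

Let preD : {morph pre : u v / u + v}.
Proof.
have pre0 : pre 0 = 0 by rewrite -(subrr 0) preB subrr.
have preN u : pre (- u) = - pre u by rewrite -sub0r preB pre0 sub0r.
by move=> u v; rewrite -[v in LHS]opprK preB preN opprK.
Qed.

Let preU b x : pre << (b, x) >> = << (g b, f x) >>.
Proof. by rewrite /pre liftU scale1r. Qed.

Let pre_rel u : tensor_rel u -> tensor_rel (pre u).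
Proof.
elim=> [|{}u v _ hu _ hv|b b' x|b x x'|b r x].
- by rewrite -(subrr 0) preB subrr; exact: TensorRel0.
- by rewrite preB; exact: TensorRelB.
- by rewrite preB preD !preU linearD; exact: TensorRelDl.
- by rewrite preB preD !preU linearD; exact: TensorRelDr.
- by rewrite preB !preU !linearZ; exact: TensorRelZ.
Qed.

Lemma tensor_map_pi u :
  tensor_map (\pi_(Quotient.quot (tensor_pred B F)) u) =
  \pi_(Quotient.quot (tensor_pred B' F')) (pre u).
Proof.
apply/eqP; rewrite -Quotient.idealrBE -preB.
apply/asboolP/pre_rel/asboolP; rewrite -[asbool _]/(_ \in tensor_pred B F).
by rewrite Quotient.idealrBE reprK.
Qed.

Lemma tensor_map_tens b x : tensor_map (tens b x) = tens (g b) (f x).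
Proof. by rewrite tensor_map_pi preU. Qed.

Lemma tensor_map_is_additive : {morph tensor_map : s t / s - t}.
Proof.
elim/quotW=> u; elim/quotW=> v.
by rewrite !tensor_map_pi -!raddfB /= tensor_map_pi preB raddfB.
Qed.

End TensorMap.

Definition tensor_mapl (R : pzRingType) (B : lmodType R^c) (F F' : lmodType R)
    (f : {linear F -> F'}) : tensor B F -> tensor B F' :=
  tensor_map (idfun : {linear B -> B}) f.

Definition tensor_mapr (R : pzRingType) (F F' : lmodType R^c) (B : lmodType R)
    (f : {linear F -> F'}) : tensor F B -> tensor F' B :=
  tensor_map f (idfun : {linear B -> B}).

Definition onto (U V : Type) (f : U -> V) : Prop := forall y, exists x, f x = y.

Definition exact_at (U V W : zmodType) (f : U -> V) (g : V -> W) : Prop :=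
  forall v, g v = 0 <-> exists u, f u = v.

(* ... -> L 1 -> L 0 -> U 0 -> U 1 -> ... *)
Definition exact_two_sided (L U : nat -> zmodType)
    (dl : forall i, L i.+1 -> L i) (dm : L 0 -> U 0)
    (du : forall i, U i -> U i.+1) : Prop :=
  [/\ forall i, exact_at (dl i.+1) (dl i), exact_at (dl 0) dm,
      exact_at dm (du 0) & forall i, exact_at (du i) (du i.+1)].

(* ... -> F_1 -> F_0 -> F^0 -> F^1 -> ... *)
Record two_sided (R : pzRingType) := TwoSided {
  lo : nat -> lmodType R;
  up : nat -> lmodType R;
  lo_d : forall i, {linear lo i.+1 -> lo i};
  mid_d : {linear lo 0 -> up 0};
  up_d : forall i, {linear up i -> up i.+1} }.

(* ... -> X_1 -> X_0 -> M *)
Record augmented (R : pzRingType) (M : lmodType R) := Augmented {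
  aug_obj : nat -> lmodType R;
  aug_d : forall i, {linear aug_obj i.+1 -> aug_obj i};
  aug_eps : {linear aug_obj 0 -> M} }.

(* Exactness of X_n -> ... -> X_0 -> M -> 0, at all terms but X_n *)
Definition exact_upto (R : pzRingType) (M : lmodType R) (n : nat)
    (X : augmented M) : Prop :=
  [/\ onto (aug_eps X), (0 < n)%N -> exact_at (aug_d X 0) (aug_eps X)
    & forall i, (i.+1 < n)%N -> exact_at (aug_d X i.+1) (aug_d X i)].

Definition resolution (R : pzRingType) (M : lmodType R) (X : augmented M) :
    Prop :=
  [/\ onto (aug_eps X), exact_at (aug_d X 0) (aug_eps X)
    & forall i, exact_at (aug_d X i.+1) (aug_d X i)].

Definition zero_module (R : pzRingType) (M : lmodType R) : Prop :=
  forall x : M, x = 0.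

(* 0 -> C_k -> ... -> C_0 -> M -> 0, extended by zero modules *)
Definition has_resolution_of_length (R : pzRingType) (C : lmodType R -> Prop)
    (M : lmodType R) (k : nat) : Prop :=
  exists X : augmented M,
    [/\ resolution X, forall i, (i <= k)%N -> C (aug_obj X i)
      & forall i, (k < i)%N -> zero_module (aug_obj X i)].

Definition resdim (R : pzRingType) (C : lmodType R -> Prop) (M : lmodType R) :
    enat :=
  least (has_resolution_of_length C M).

Definition lflat (R : pzRingType) (F : lmodType R) : Prop :=
  forall (A B C : lmodType R^c) (f : {linear A -> B}) (g : {linear B -> C}),
    exact_at f g -> exact_at (tensor_mapr (B := F) f) (tensor_mapr (B := F) g).

Definition rflat (R : pzRingType) (F : lmodType R^c) : Prop :=
  forall (A B C : lmodType R) (f : {linear A -> B}) (g : {linear B -> C}),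
    exact_at f g -> exact_at (tensor_mapl (B := F) f) (tensor_mapl (B := F) g).

Definition lfd (R : pzRingType) (M : lmodType R) : enat := resdim (@lflat R) M.

Definition rfd (R : pzRingType) (M : lmodType R^c) : enat :=
  resdim (@rflat R) M.

Definition lfd_class (R : pzRingType) (X : lmodType R -> Prop) : enat :=
  esup X (@lfd R).

Definition rfd_class (R : pzRingType) (X : lmodType R^c -> Prop) : enat :=
  esup X (@rfd R).

Definition fg_free (R : pzRingType) (P : lmodType R) : Prop :=
  exists (k : nat) (f : {linear P -> 'rV[R]_k}), bijective f.

Definition FP (R : pzRingType) (n : nat) (M : lmodType R) : Prop :=
  exists X : augmented M,
    exact_upto n X /\ forall i, (i <= n)%N -> fg_free (aug_obj X i).

Definition projective (R : pzRingType) (P : lmodType R) : Prop :=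
  forall (U V : lmodType R) (g : {linear U -> V}) (f : {linear P -> V}),
    onto g -> exists h : {linear P -> U}, forall x, g (h x) = f x.

(* Ext^1_R(M, E) = H^1(Hom_R(P, E)) = 0 for projective resolutions P of M:
   every 1-cocycle of Hom_R(P, E) is a coboundary. *)
Definition Ext1_zero (R : pzRingType) (M E : lmodType R) : Prop :=
  forall P : augmented M,
    resolution P -> (forall i, projective (aug_obj P i)) ->
  forall f : {linear aug_obj P 1 -> E},
    (forall x, f (aug_d P 1 x) = 0) ->
  exists g : {linear aug_obj P 0 -> E}, forall x, g (aug_d P 0 x) = f x.

Definition FP_inj (R : pzRingType) (n : nat) (E : lmodType R) : Prop :=
  forall M : lmodType R, FP n M -> Ext1_zero M E.
Arguments FP_inj R%_type_scope n E : clear implicits.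

Definition left_coherent (R : pzRingType) (n : nat) : Prop :=
  forall M : lmodType R, FP n M -> FP n.+1 M.

Definition right_coherent (R : pzRingType) (n : nat) : Prop :=
  left_coherent R^c n.

Definition Gorenstein_coherent (R : pzRingType) (n : nat) : Prop :=
  [/\ left_coherent R n, right_coherent R n
    & exists m : nat,
        (forall M : lmodType R, FP_inj R n M -> enat_le (lfd M) m) /\
        (forall N : lmodType R^c, FP_inj R^c n N -> enat_le (rfd N) m)].

Definition exact_complex (R : pzRingType) (X : two_sided R) : Prop :=
  exact_two_sided (L := lo X) (U := up X) (lo_d X) (mid_d X) (up_d X).

Definition is_kernel (R : pzRingType) (G U V : lmodType R)
    (d : {linear U -> V}) : Prop :=
  exists iota : {linear G -> U}, injective iota /\ exact_at iota d.
Arguments is_kernel [R] G [U V] d.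

Definition lGF (R : pzRingType) (B : lmodType R^c -> Prop) (G : lmodType R) :
    Prop :=
  exists X : two_sided R,
    [/\ forall i, lflat (lo X i) /\ lflat (up X i), exact_complex X,
        forall N, B N ->
          exact_two_sided (fun i => tensor_mapl (B := N) (lo_d X i))
            (tensor_mapl (B := N) (mid_d X))
            (fun i => tensor_mapl (B := N) (up_d X i))
      & is_kernel G (up_d X 0)].

Definition rGF (R : pzRingType) (B : lmodType R -> Prop) (G : lmodType R^c) :
    Prop :=
  exists X : two_sided R^c,
    [/\ forall i, rflat (lo X i) /\ rflat (up X i), exact_complex X,
        forall N, B N ->
          exact_two_sided (fun i => tensor_mapr (B := N) (lo_d X i))
            (tensor_mapr (B := N) (mid_d X))
            (fun i => tensor_mapr (B := N) (up_d X i))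
      & is_kernel G (up_d X 0)].

Definition lGfd (R : pzRingType) (B : lmodType R^c -> Prop) (M : lmodType R) :
    enat :=
  resdim (lGF B) M.

Definition rGfd (R : pzRingType) (B : lmodType R -> Prop) (M : lmodType R^c) :
    enat :=
  resdim (rGF B) M.

Definition lwGgl (R : pzRingType) (B : lmodType R^c -> Prop) : enat :=
  esup (fun _ : lmodType R => True) (lGfd B).

Definition rwGgl (R : pzRingType) (B : lmodType R -> Prop) : enat :=
  esup (fun _ : lmodType R^c => True) (rGfd B).

(* Main.v *)
From HB Require Import structures.
Require Import Defs.
From mathcomp Require Import all_boot all_order all_algebra.
From mathcomp Require Import boolp classical_sets functions freeg.

Set Implicit Arguments.
Unset Strict Implicit.
Unset Printing Implicit Defensive.

Import Order.TTheory GRing.Theory Num.Theory.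
Local Open Scope classical_set_scope.
Local Open Scope quotient_scope.
Local Open Scope ring_scope.

(** Write B for the class of FP_n-injective right modules and J for the class
    of FP_n-injective left modules, and let m be a natural number.  The theorem
    follows from two implications.

    If every left module M has a GF_B-resolution of length at most m, then every
    N in B has flat dimension at most m ([flat_dim_of_GF_dim]).  Indeed
    Tor_i(N, G) = 0 for i > 0 and G in GF_B, so shifting dimensions along the
    resolution of M gives Tor_(m+1)(N, M) = 0; as M is arbitrary, the m-th
    syzygy of N is flat.

    Conversely, if fd(B) <= m and fd(J) <= m, then the m-th syzygy K of any left
    module M lies in GF_B, so M has a GF_B-resolution of length m
    ([GF_dim_of_flat_dim]).  On the left, a free resolution of K stays exact
    under N (x) - for N in B, because Tor_(m+1)(N, -) = 0.  On the right, embed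
    M into an injective module E with cokernel C.  The horseshoe lemma turns
    0 -> M -> E -> C -> 0 into an exact sequence 0 -> K -> Q -> K' -> 0 in which
    K' is the m-th syzygy of C and Q is an m-th syzygy of E.  As E belongs to J,
    the module Q is flat, and the construction can be repeated with K'.

    Both implications have mirror images in which left and right are exchanged.
    When fd(B) = fd(J), they say that each of the two global dimensions is at
    most m exactly when this common flat dimension is.

    The homological algebra is reduced to one predicate, [tor_zero], for the
    vanishing of Tor_1; higher Tor groups are reached by replacing a module by
    its syzygies.  The balance of Tor is a chase in a 3 x 3 diagram ([chase]).
    To get the mirror images for free, everything is proved for an abstract
    balanced tensor product ([tensor_theory]), a notion with an evident symmetry
    ([flip]).  Enough injective modules are provided by the products of copies
    of Hom_Z(R, Q/Z). *)

(** * Submodules, quotients and free modules *)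

Definition additive_map (U V : zmodType) (f : U -> V) :=
  {morph f : x y / x - y}.

Section AdditiveMap.
Variables (U V : zmodType) (f : U -> V) (fB : additive_map f).
Lemma additive0 : f 0 = 0. Proof. by rewrite -(subrr 0) fB subrr. Qed.
Lemma additiveN x : f (- x) = - f x.
Proof.
by rewrite -sub0r fB additive0 sub0r.
Qed.
Lemma additiveD x y : f (x + y) = f x + f y.
Proof. by rewrite -[y in LHS]opprK fB additiveN opprK. Qed.
End AdditiveMap.

Definition mk_linear (R : pzRingType) (U V : lmodType R) (f : U -> V)
    (f_lin : linear f) : {linear U -> V} :=
  HB.pack f (GRing.isLinear.Build R U V *:%R f f_lin).

Section Linear.
Variables (R : pzRingType) (U V W : lmodType R).

Lemma corestrict (i : {linear V -> W}) (f : {linear U -> W}) :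
  injective i -> (forall u, exists v, i v = f u) ->
  exists h : {linear U -> V}, forall u, i (h u) = f u.
Proof.
move=> i_inj im; pose h u := sval (cid (im u)).
have hE u : i (h u) = f u by rewrite /h; case: cid.
have h_lin : linear h by move=> a x y; apply: i_inj;
  rewrite linearP !hE linearP.
by exists (mk_linear h_lin).
Qed.

Lemma descend (p : {linear U -> V}) (f : {linear U -> W}) :
  onto p -> (forall u, p u = 0 -> f u = 0) ->
  exists h : {linear V -> W}, forall u, h (p u) = f u.
Proof.
move=> p_onto ker_sub; pose h v := f (sval (cid (p_onto v))).
have hE u : h (p u) = f u.
  rewrite /h; case: cid => u' /= pu'; apply/eqP; rewrite -subr_eq0 -linearB.
  by apply/eqP/ker_sub; rewrite linearB pu' subrr.
have h_lin : linear h.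
  move=> a x y; have [x' <-] := p_onto x; have [y' <-] := p_onto y.
  by rewrite -linearP !hE linearP.
by exists (mk_linear h_lin).
Qed.

End Linear.

Lemma additive_inj (U V : zmodType) (f : U -> V) :
  {morph f : x y / x - y} -> (forall x, f x = 0 -> x = 0) -> injective f.
Proof.
by move=> fB f0 x y fxy; apply/eqP; rewrite -subr_eq0; apply/eqP/f0;
  rewrite fB fxy subrr.
Qed.

Lemma linear_inj (R : pzRingType) (U V : lmodType R) (f : {linear U -> V}) :
  (forall x, f x = 0 -> x = 0) -> injective f.
Proof. by apply: additive_inj => x y; rewrite linearB. Qed.

Section Submodule.
Variables (R : pzRingType) (V : lmodType R).

Record submodule := Submodule {
  in_sub :> V -> Prop;
  in_sub_closed : subsemimod_closed (fun x => `[< in_sub x >]) }.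

Lemma submodule_closed (P : V -> Prop) :
  P 0 -> (forall a x y, P x -> P y -> P (a *: x + y)) ->
  subsemimod_closed (fun x => `[< P x >]).
Proof.
move=> P0 Plin; split; first split; first exact/asboolP.
- by move=> x y /asboolP Px /asboolP Py; apply/asboolP; rewrite -[x]scale1r;
  exact: Plin.
- by move=> a x /asboolP Px; apply/asboolP; rewrite -[_ *: _]addr0; exact: Plin.
Qed.

Variable W : submodule.
Definition sub_mem : {pred V} := fun x => `[< W x >].

Definition submod : Type := {x : V | sub_mem x}.
HB.instance Definition _ := SubChoice.copy submod {x : V | sub_mem x}.
HB.instance Definition _ :=
  GRing.SubChoice_isSubLmodule.Build R V sub_mem submod (in_sub_closed W).

Definition submod_in : {linear submod -> V} := (val : {linear submod -> V}).

Lemma submod_in_inj : injective submod_in. Proof. exact: val_inj. Qed.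
Lemma submod_inP x : W x <-> exists y, submod_in y = x.
Proof.
split=> [Wx|[y <-]]; last by apply/asboolP; exact: (valP y).
have Wx' : sub_mem x by apply/asboolP.
by exists (exist _ x Wx' : submod).
Qed.

HB.instance Definition _ := GRing.isSubmodClosed.Build R V sub_mem
  (in_sub_closed W).

Definition quot_mod : Type := Quotient.quot sub_mem.
HB.instance Definition _ := GRing.Zmodule.on quot_mod.

Definition quot_pi (x : V) : quot_mod := \pi_(Quotient.quot sub_mem) x.

Lemma quot_piP x y : quot_pi x = quot_pi y <-> W (x - y).
Proof.
rewrite /quot_pi; split=> [/eqP|Wxy].
  by rewrite -Quotient.idealrBE => /asboolP.
by apply/eqP; rewrite -Quotient.idealrBE; apply/asboolP.
Qed.

Lemma quot_piB : {morph quot_pi : x y / x - y}.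
Proof. by move=> x y; rewrite /quot_pi raddfB. Qed.

Lemma quot_piD : {morph quot_pi : x y / x + y}.
Proof. by move=> x y; rewrite /quot_pi raddfD. Qed.

Lemma quot_onto : onto quot_pi.
Proof.
by move=> y; exists (repr (y : Quotient.quot sub_mem)); rewrite /quot_pi reprK.
Qed.

Definition quot_scale (a : R) (y : quot_mod) : quot_mod :=
  quot_pi (a *: repr (y : Quotient.quot sub_mem)).

Lemma quot_scale_pi a x : quot_scale a (quot_pi x) = quot_pi (a *: x).
Proof.
apply/quot_piP; rewrite -scalerBr.
have /quot_piP/asboolP Wd : quot_pi (repr (quot_pi x : Quotient.quot sub_mem))
  = quot_pi x.
  by rewrite /quot_pi reprK.
by apply/asboolP/(GRing.subsemimod_closedZ (in_sub_closed W)).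
Qed.

Fact quot_scaleA a b y : quot_scale a (quot_scale b y) = quot_scale (a * b) y.
Proof. by have [x <-] := quot_onto y; rewrite !quot_scale_pi scalerA. Qed.
Fact quot_scale1 : left_id 1 quot_scale.
Proof.
by move=> y; have [x <-] := quot_onto y; rewrite quot_scale_pi scale1r.
Qed.
Fact quot_scaleDr : right_distributive quot_scale +%R.
Proof.
move=> a y z; have [x <-] := quot_onto y; have [x' <-] := quot_onto z.
by rewrite -quot_piD !quot_scale_pi -quot_piD scalerDr.
Qed.
Fact quot_scaleDl y : {morph quot_scale^~ y : a b / a + b}.
Proof.
by move=> a b; have [x <-] := quot_onto y; rewrite !quot_scale_pi scalerDl
  quot_piD.
Qed.
HB.instance Definition _ := GRing.Zmodule_isLmodule.Build R quot_mod
  quot_scaleA quot_scale1 quot_scaleDr quot_scaleDl.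

Fact quot_pi_linear : linear quot_pi.
Proof. by move=> a x y; rewrite quot_piD -quot_scale_pi. Qed.

Definition quot_map : {linear V -> quot_mod} := mk_linear quot_pi_linear.

Lemma quot_map_onto : onto quot_map. Proof. exact: quot_onto. Qed.
Lemma quot_map0 x : quot_map x = 0 <-> W x.
Proof.
rewrite -[0](linear0 quot_map); split=> [/quot_piP|Wx]; first by rewrite subr0.
by apply/quot_piP; rewrite subr0.
Qed.

End Submodule.

Definition ses (R : pzRingType) (K X M : lmodType R) (i : {linear K -> X})
    (p : {linear X -> M}) : Prop :=
  [/\ injective i, exact_at i p & onto p].

Section KerCoker.
Variables (R : pzRingType) (U V : lmodType R) (f : {linear U -> V}).

Fact ker_closed : subsemimod_closed (fun x => `[< f x = 0 >]).
Proof.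
apply: submodule_closed; first exact: linear0.
by move=> a x y fx fy; rewrite linearP fx fy scaler0 addr0.
Qed.
Definition ker : lmodType R := submod (Submodule ker_closed).
Definition ker_in : {linear ker -> U} := submod_in _.

Lemma ker_ses : onto f -> ses ker_in f.
Proof.
by move=> f_onto; split; [exact: submod_in_inj | exact: (submod_inP (Submodule
  ker_closed)) |].
Qed.

Fact im_closed : subsemimod_closed (fun y => `[< exists x, f x = y >]).
Proof.
apply: submodule_closed; first by exists 0; rewrite linear0.
by move=> a _ _ [x <-] [y <-]; exists (a *: x + y); rewrite linearP.
Qed.
Definition coker : lmodType R := quot_mod (Submodule im_closed).
Definition coker_pi : {linear V -> coker} := quot_map _.

Lemma coker_onto : onto coker_pi. Proof. exact: quot_map_onto. Qed.
Lemma coker_exact : exact_at f coker_pi.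
Proof. by move=> y; exact: quot_map0. Qed.

Lemma coker_ses : injective f -> ses f coker_pi.
Proof.
by move=> f_inj; split; [|exact: coker_exact | exact: quot_map_onto].
Qed.

Definition image_mod : lmodType R := submod (Submodule im_closed).
Definition image_in : {linear image_mod -> V} := submod_in _.
Lemma image_in_inj : injective image_in. Proof. exact: submod_in_inj. Qed.
Lemma image_inP y : (exists x, f x = y) <-> exists z, image_in z = y.
Proof. exact: (submod_inP (Submodule im_closed)). Qed.

End KerCoker.

Section Free.
Variables (R : pzRingType) (X : choiceType).

Fact free_closed :
  subsemimod_closed (fun f : X -> R^o =>
    `[< exists s : seq X, forall x, x \notin s -> f x = 0 >]).
Proof.
apply: submodule_closed; first by exists [::].
move=> a f g [s fs] [t gt]; exists (s ++ t) => x.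
rewrite mem_cat negb_or => /andP[xs xt].
by rewrite -[LHS]/(a *: f x + g x) fs // gt // scaler0 addr0.
Qed.

(** Finitely supported functions rather than formal sums: this also makes
    sense over the zero ring, where 1 = 0. *)
Definition free_mod : lmodType R := submod (Submodule free_closed).
Definition coef (f : free_mod) : X -> R := submod_in (Submodule free_closed) f.

Lemma coefD f g x : coef (f + g) x = coef f x + coef g x.
Proof. by rewrite /coef linearD. Qed.
Lemma coefB f g x : coef (f - g) x = coef f x - coef g x.
Proof. by rewrite /coef linearB. Qed.
Lemma coefZ a f x : coef (a *: f) x = a * coef f x.
Proof. by rewrite /coef linearZ. Qed.
Lemma coef0 x : coef 0 x = 0.
Proof. by rewrite /coef linear0. Qed.
Lemma coef_inj f g : coef f =1 coef g -> f = g.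
Proof.
by move=> /funext fg; exact: (@submod_in_inj _ _ (Submodule free_closed)
  f g fg).
Qed.

Definition covers (s : seq X) (f : free_mod) :=
  uniq s /\ forall x, x \notin s -> coef f x = 0.

Lemma covered f : exists s, covers s f.
Proof.
have /submod_inP/= : exists y, submod_in (Submodule free_closed)
  y = coef f by exists f.
case=> s fs; exists (undup s); split; first exact: undup_uniq.
by move=> x; rewrite mem_undup; exact: fs.
Qed.

Lemma covers_super s t f : covers s f -> uniq t -> {subset s <= t} ->
    covers t f.
Proof.
by move=> [_ fs] ut st; split=> // x xt; apply: fs; apply: contra xt; exact: st.
Qed.

Lemma covered2 f g : exists s, covers s f /\ covers s g.
Proof.
have [s sf] := covered f; have [t tg] := covered g.
have u : uniq (undup (s ++ t)) by exact: undup_uniq.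
exists (undup (s ++ t)); split.
  by apply: covers_super sf u _ => x; rewrite mem_undup mem_cat => ->.
by apply: covers_super tg u _ => x; rewrite mem_undup mem_cat => ->;
  rewrite orbT.
Qed.

Definition delta (x : X) : X -> R^o := fun y => if y == x then 1 else 0.
Fact delta_free x : sub_mem (Submodule free_closed) (delta x).
Proof.
by apply/asboolP; exists [:: x] => y; rewrite inE /delta => /negPf ->.
Qed.
Definition basis (x : X) : free_mod := exist _ (delta x) (delta_free x).
Lemma coef_basis x y : coef (basis x) y = if y == x then 1 else 0.
Proof. by []. Qed.

Lemma free_sum s f : covers s f -> f = \sum_(x <- s) coef f x *: basis x.
Proof.
move=> [us fs]; apply: coef_inj => y.
have coef_sum (F : X -> free_mod) r : coef (\sum_(x <- r) F x)
  y = \sum_(x <- r) coef (F x) y.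
  by elim/big_rec2: _ => [|x a b _ <-]; rewrite ?coef0 ?coefD.
rewrite coef_sum.
have [ys|ys] := boolP (y \in s); last first.
  rewrite fs // big1_seq // => x /andP[_ xs]; rewrite coefZ coef_basis.
  by case: eqP => [yx|_]; rewrite ?mulr0 //; rewrite yx xs in ys.
rewrite (bigD1_seq y) //= big1 => [|x xy]; rewrite coefZ coef_basis ?eqxx
  ?mulr1 ?addr0 //.
by rewrite eq_sym (negPf xy) mulr0.
Qed.

Section Extension.
Variables (V : lmodType R) (h : X -> V).

Definition free_ext (f : free_mod) : V := \sum_(x <- sval (cid (covered f)))
    coef f x *: h x.

Lemma free_extE s f : covers s f -> free_ext f = \sum_(x <- s) coef f x *: h x.
Proof.
have aux t u g : covers t g -> uniq u -> {subset t <= u} ->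
    \sum_(x <- t) coef g x *: h x = \sum_(x <- u) coef g x *: h x.
  move=> [ut gt] uu tu; rewrite [RHS](bigID (mem t)) /= [X in _ + X]big1;
    last first.
    by move=> x /gt ->; rewrite scale0r.
  rewrite addr0 -[RHS]big_filter; apply: perm_big; apply: uniq_perm => //.
    exact: filter_uniq.
  move=> x; rewrite mem_filter; have [xt|//] := boolP (x \in t).
  by rewrite tu.
move=> sf; rewrite /free_ext; case: cid => t /= tf.
have u : uniq (undup (s ++ t)) by exact: undup_uniq.
rewrite (aux t _ f tf u) ?(aux s _ f sf u) // => x;
  rewrite mem_undup mem_cat => ->;
by rewrite ?orbT.
Qed.

Fact free_ext_linear : linear free_ext.
Proof.
move=> a f g; have [s [sf sg]] := covered2 f g.
have sfg : covers s (a *: f + g).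
  split; first by case: sf.
  by move=> x xs; rewrite coefD coefZ sf.2 // sg.2 // mulr0 addr0.
rewrite (free_extE sf) (free_extE sg) (free_extE sfg) scaler_sumr -big_split /=.
by apply: eq_bigr => x _; rewrite coefD coefZ scalerDl scalerA.
Qed.
Definition free_lift : {linear free_mod -> V} := mk_linear free_ext_linear.

Lemma free_lift_basis x : free_lift (basis x) = h x.
Proof.
have c : covers [:: x] (basis x).
  by split=> // y; rewrite inE coef_basis => /negPf ->.
by rewrite /free_lift /= (free_extE c) big_seq1 coef_basis eqxx scale1r.
Qed.

End Extension.
End Free.

Lemma free_lift_unique (R : pzRingType) (X : choiceType) (V : lmodType R)
    (f g : {linear free_mod R X -> V}) :
  (forall x, f (basis R x) = g (basis R x)) -> f =1 g.
Proof.
move=> fg u; have [s su] := covered u; rewrite (free_sum su) !linear_sum.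
by apply: eq_bigr => x _; rewrite !linearZ /= fg.
Qed.

Section Cover.
Variables (R : pzRingType) (M : lmodType R).
Definition cover : {linear free_mod R M -> M} := free_lift id.
Lemma cover_basis x : cover (basis R x) = x. Proof. exact: free_lift_basis. Qed.
Lemma cover_onto : onto cover.
Proof. by move=> x; exists (basis R x); exact: cover_basis. Qed.
(** The syzygy is taken in the canonical free cover, on all elements of [M], so
    that it is a function of [M] and can be iterated. *)
Definition Omega : lmodType R := ker cover.
Lemma Omega_ses : ses (ker_in cover) cover.
Proof. by apply: ker_ses; exact: cover_onto. Qed.
End Cover.

(** * Tensor products, with the two sides on an equal footing *)

Definition balanced (T S : pzRingType) (anti : S -> T) (N : lmodType T)
    (M : lmodType S) (Z : zmodType) (b : N -> M -> Z) : Prop :=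
  [/\ forall m, additive_map (b^~ m), forall n, additive_map (b n)
    & forall n m s, b (anti s *: n) m = b n (s *: m)].

(** A tensor product of right modules and left modules, in which the right
    modules over a ring are seen as left modules over another ring [T] that is
    anti-isomorphic to [S].  Keeping the two rings apart lets the roles of the
    factors be exchanged: over the twice opposite ring, which is not
    convertible to the ring itself, the exchanged tensor product would not have
    the right type. *)
Record tensor_theory (T S : pzRingType) := TensorTheory {
  anti : S -> T;
  anti_inv : T -> S;
  anti_invK : cancel anti_inv anti;
  antiK : cancel anti anti_inv;
  antiB : additive_map anti;
  antiM : forall a b, anti (a * b) = anti b * anti a;
  ten : lmodType T -> lmodType S -> zmodType;
  pure : forall (N : lmodType T) (M : lmodType S), N -> M -> ten N M;
  pure_balanced : forall N M, balanced anti (@pure N M);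
  ten_ind : forall (N : lmodType T) (M : lmodType S)
      (P : ten N M -> Prop), P 0 ->
    (forall u v, P u -> P v -> P (u - v)) -> (forall n m, P (pure n m)) ->
    forall u, P u;
  ten_lift : forall (N : lmodType T) (M : lmodType S) (Z : zmodType)
      (b : N -> M -> Z), balanced anti b ->
    exists2 h : ten N M -> Z, additive_map h & forall n m, h (pure n m) = b n m;
  tmap : forall (N N' : lmodType T) (M M' : lmodType S),
    {linear N -> N'} -> {linear M -> M'} -> ten N M -> ten N' M';
  tmapB : forall (N N' : lmodType T) (M M' : lmodType S)
      (g : {linear N -> N'}) (f : {linear M -> M'}),
    additive_map (tmap g f);
  tmap_pure : forall (N N' : lmodType T) (M M' : lmodType S)
      (g : {linear N -> N'}) (f : {linear M -> M'}) n m,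
    tmap g f (pure n m) = pure (g n) (f m) }.

Arguments pure {T S} t {N M} n m.
Arguments tmap {T S} t {N N' M M'} g f u.
Arguments tmapB {T S} t {N N' M M'} g f.
Arguments tmap_pure {T S} t {N N' M M'} g f n m.
Arguments pure_balanced {T S} t N M.
Arguments ten_ind {T S} t {N M} P.
Arguments ten_lift {T S} t {N M Z b}.

Section Flip.
Variables (T S : pzRingType) (t : tensor_theory T S).
Lemma anti_invB : additive_map (anti_inv t).
Proof. by move=> x y; apply: (can_inj (antiK t)); rewrite antiB !anti_invK. Qed.
Lemma anti_invM a b : anti_inv t (a * b) = anti_inv t b * anti_inv t a.
Proof. by apply: (can_inj (antiK t)); rewrite antiM !anti_invK. Qed.

Lemma balanced_flip (N : lmodType T) (M : lmodType S) (Z : zmodType)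
    (b : N -> M -> Z) :
  balanced (anti t) b <-> balanced (anti_inv t) (fun m n => b n m).
Proof.
split=> -[bl br bb]; split=> // n m s; first by rewrite -bb anti_invK.
by rewrite -(bb m) antiK.
Qed.

Definition flip : tensor_theory S T.
refine (@TensorTheory S T (anti_inv t) (anti t) (antiK t) (anti_invK t)
  anti_invB anti_invM
   (fun M N => ten t N M) (fun M N m n => pure t n m) _ _ _
   (fun M M' N N' f g => tmap t g f) _ _).
- by move=> M N; apply/balanced_flip; exact: pure_balanced.
- by move=> M N P P0 PB Pp u; apply: (ten_ind t) => // n m; exact: Pp.
- move=> M N Z b bb; have /(ten_lift t)[h hB hE] : balanced (anti t)
  (fun n m => b m n) by apply/balanced_flip.
  by exists h.
- by move=> *; exact: tmapB.
- by move=> *; exact: tmap_pure.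
Defined.
End Flip.

Section Std.
Variable R : pzRingType.

Let anti_id : R -> R^c := id.

Section Objects.
Variables (N : lmodType R^c) (M : lmodType R).

Let tensor_eq (u v : {freeg (N * M)%type}) : tensor_rel (u - v) ->
  \pi_(Quotient.quot (tensor_pred N M)) u = \pi_(Quotient.quot (tensor_pred N
    M)) v.
Proof. by move=> uv; apply/eqP; rewrite -Quotient.idealrBE; apply/asboolP. Qed.

Lemma tens_balanced : balanced anti_id (@tens R N M).
Proof.
have tD (U V : zmodType) (f : U -> V) : {morph f : x y / x + y} ->
  additive_map f.
  move=> fD; have f0 : f 0 = 0 by apply: (@addrI _ (f 0)); rewrite -fD !addr0.
  move=> x y; rewrite fD; congr (_ + _); apply: (@addrI _ (f y)).
  by rewrite -fD !subrr f0.
split=> [m|n|n m s].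
- by apply: tD => x y; rewrite /tens -raddfD; apply: tensor_eq;
  exact: TensorRelDl.
- by apply: tD => x y; rewrite /tens -raddfD; apply: tensor_eq;
  exact: TensorRelDr.
- by apply: tensor_eq; exact: TensorRelZ.
Qed.

Lemma tensor_ind (P : tensor N M -> Prop) : P 0 ->
    (forall u v, P u -> P v -> P (u - v)) -> (forall n m, P (tens n m)) ->
    forall u, P u.
Proof.
move=> P0 PB Pp; elim/quotW => u.
have PN v : P v -> P (- v) by move=> Pv; rewrite -sub0r; exact: PB.
have PD v w : P v -> P w -> P (v + w) by move=> Pv Pw; rewrite -[w]opprK;
  exact: PB (PN _ Pw).
rewrite -[u]freeg_sumE raddf_sum /=.
elim/big_ind: _ => // -[n m] _; rewrite -[coeff _ _]intz -freegU_mulz raddfMz.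
have PM k : P (tens n m *+ k) by elim: k => // k IH; rewrite mulrS; exact: PD.
case: (coeff _ _) => k; [exact: PM | rewrite NegzE mulrNz; exact/PN/PM].
Qed.

Lemma tensor_lift (Z : zmodType) (b : N -> M -> Z) : balanced anti_id b ->
    exists2 h : tensor N M -> Z, additive_map h & forall n m, h (tens n m)
      = b n m.
Proof.
case=> bl br bb.
pose pre : {freeg (N * M)%type} -> zmodule Z := fglift (fun p =>
  b p.1 p.2 : zmodule Z).
have preB : additive_map pre by exact: lift_is_additive.
have preU n m : pre (free_pure n m) = b n m by rewrite /pre liftU scale1r.
have pre_rel u : tensor_rel u -> pre u = 0.
  elim=> [|{}u v _ hu _ hv|n n' m|n m m'|n r m].
  - exact: additive0.
  - by rewrite preB hu hv subrr.
  - by rewrite preB (additiveD preB) !preU (additiveD (bl m)) subrr.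
  - by rewrite preB (additiveD preB) !preU (additiveD (br n)) subrr.
  - by rewrite preB !preU -[_ *: n]/(anti_id r *: n) bb subrr.
pose h (t : tensor N M) : Z := pre (repr (t : Quotient.quot (tensor_pred N M))).
have hE u : h (\pi_(Quotient.quot (tensor_pred N M)) u) = pre u.
  apply/eqP; rewrite -subr_eq0 -preB; apply/eqP/pre_rel/asboolP.
  by rewrite -[asbool _]/(_ \in tensor_pred N M) Quotient.idealrBE reprK.
exists h => [|n m]; last by rewrite hE preU.
by elim/quotW => u; elim/quotW => v; rewrite -raddfB !hE preB.
Qed.
End Objects.

Definition std_tensor : tensor_theory R^c R.
refine (@TensorTheory R^c R anti_id id _ _ _ _ (@tensor R) (@tens R)
  tens_balanced
   tensor_ind tensor_lift (@tensor_map R) (@tensor_map_is_additive R)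
     (@tensor_map_tens R)) => //.
Defined.
End Std.

(** * Vanishing of Tor *)

Section ZmodQuotient.
Variables (U V : zmodType) (f : U -> V) (fB : additive_map f).

Fact zim_closed : @GRing.subsemimod_closed int (zmodule V)
   (fun y => `[< exists x, f x = y >]).
Proof.
apply: submodule_closed; first by exists 0; exact: additive0.
have fMn n x : f (x *+ n) = f x *+ n.
  by elim: n => [|n IH]; rewrite ?(additive0 fB) // !mulrS (additiveD fB) IH.
have fM k x : f (x *~ k) = f x *~ k.
  by case: k => n; rewrite ?NegzE ?mulrNz ?(additiveN fB) fMn.
by move=> a _ _ [x <-] [y <-]; exists (x *~ a + y); rewrite (additiveD fB) fM.
Qed.

(** Abelian groups are modules over the integers, so that the quotient of
    modules provides cokernels of additive maps. *)
Lemma zmod_coker : exists (Z : zmodType) (q : V -> Z),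
  additive_map q /\ forall y, q y = 0 <-> exists x, f x = y.
Proof.
exists (quot_mod (Submodule zim_closed)), (quot_pi (Submodule zim_closed)).
split; first by move=> x y; rewrite /= -(quot_piB (Submodule zim_closed)).
by move=> y; exact: (quot_map0 (Submodule zim_closed)).
Qed.
End ZmodQuotient.

Section Functor.
Variables (T S : pzRingType) (t : tensor_theory T S).

Definition tmapl (N : lmodType T) (M M' : lmodType S) (f : {linear M -> M'}) :=
  tmap t (idfun : {linear N -> N}) f.
Definition tmapr (N N' : lmodType T) (M : lmodType S) (f : {linear N -> N'}) :=
  tmap t f (idfun : {linear M -> M}).

Arguments tmapl N {M M'} f _.
Arguments tmapr {N N'} M f _.

Lemma tmapl_pure (N : lmodType T) (M M' : lmodType S)
    (f : {linear M -> M'}) n m :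
  tmapl N f (pure t n m) = pure t n (f m).
Proof. exact: tmap_pure. Qed.
Lemma tmapr_pure (N N' : lmodType T) (M : lmodType S)
    (f : {linear N -> N'}) n m :
  tmapr M f (pure t n m) = pure t (f n) m.
Proof. exact: tmap_pure. Qed.

Lemma ten_ext (N : lmodType T) (M : lmodType S) (Z : zmodType)
    (f g : ten t N M -> Z) : additive_map f -> additive_map g ->
  (forall n m, f (pure t n m) = g (pure t n m)) -> f =1 g.
Proof.
move=> fB gB fg; apply: (ten_ind t) => // [|u v fu fv];
  first by rewrite !additive0.
by rewrite fB gB fu fv.
Qed.

Lemma additive_comp (U V W : zmodType) (f : U -> V) (g : V -> W) :
  additive_map f -> additive_map g -> additive_map (fun x => g (f x)).
Proof. by move=> fB gB x y; rewrite fB gB. Qed.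

Lemma tmap_comp (N N1 N2 : lmodType T) (M M1 M2 : lmodType S)
    (g : {linear N -> N1}) (g' : {linear N1 -> N2}) (g'' : {linear N -> N2})
    (f : {linear M -> M1}) (f' : {linear M1 -> M2}) (f'' : {linear M -> M2}) :
  (forall n, g' (g n) = g'' n) -> (forall m, f' (f m) = f'' m) ->
  forall u, tmap t g' f' (tmap t g f u) = tmap t g'' f'' u.
Proof.
move=> gE fE; apply: ten_ext => [||n m]; last by rewrite !tmap_pure gE fE.
  by apply: additive_comp; exact: tmapB.
exact: tmapB.
Qed.

Lemma tmap_lr (N N' : lmodType T) (M M' : lmodType S)
    (g : {linear N -> N'}) (f : {linear M -> M'}) u :
  tmapl N' f (tmapr M g u) = tmapr M' g (tmapl N f u).
Proof.
by rewrite /tmapl /tmapr !(tmap_comp (g'' := g) (f'' := f)).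
Qed.

Lemma pure0r (N : lmodType T) (M : lmodType S) (n : N) : pure t n (0 : M) = 0.
Proof. by case: (pure_balanced t N M) => _ pr _; exact: additive0 (pr n). Qed.

Lemma tmapl_onto (N : lmodType T) (X M : lmodType S) (p : {linear X -> M}) :
  onto p -> onto (tmapl N p).
Proof.
move=> p_onto; apply: (ten_ind t) => [|u v [u' <-] [v' <-]|n m].
- by exists 0; exact: additive0 (tmapB t _ _).
- by exists (u' - v'); exact: tmapB.
- by have [x <-] := p_onto m; exists (pure t n x); exact: tmapl_pure.
Qed.

Lemma tmapl_zero (N : lmodType T) (K X M : lmodType S) (i : {linear K -> X})
    (p : {linear X -> M}) :
  (forall k, p (i k) = 0) -> forall u, tmapl N p (tmapl N i u) = 0.
Proof.
move=> pi0; apply: ten_ext => [||n k].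
- by apply: additive_comp; exact: tmapB.
- by move=> x y; rewrite subrr.
by rewrite !tmapl_pure pi0 pure0r.
Qed.

(** Right exactness.  Let [q] be the cokernel of [N (x) i].  Since [q] does not
    see the choice of preimages under [p], it descends to an additive map [h]
    on [N (x) M]; then [h] composed with [N (x) p] is [q], so that the kernel
    of [N (x) p] is contained in that of [q], the image of [N (x) i]. *)
Lemma tmapl_exact (N : lmodType T) (K X M : lmodType S) (i : {linear K -> X})
    (p : {linear X -> M}) :
  exact_at i p -> onto p -> exact_at (tmapl N i) (tmapl N p).
Proof.
move=> ip p_onto.
have pi0 k : p (i k) = 0 by apply/ip; exists k.
move=> v; split=> [|[u <-]]; last exact: tmapl_zero.
have [Z [q [qB qE]]] := zmod_coker (tmapB t (idfun : {linear N -> N}) i).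
have q_indep n x y : p x = p y -> q (pure t n x) = q (pure t n y).
  move=> pxy; apply/eqP; rewrite -subr_eq0 -qB.
  case: (pure_balanced t N X) => _ pr _; rewrite -pr; apply/eqP/qE.
  have [k kE] : exists k, i k = x - y by apply/ip; rewrite linearB pxy subrr.
  by exists (pure t n k); rewrite -kE; exact: tmapl_pure.
pose b n m := q (pure t n (sval (cid (p_onto m)))).
have bE n x : b n (p x) = q (pure t n x).
  by rewrite /b; case: cid => y /= ?; exact: q_indep.
have [pl pr pb] := pure_balanced t N X.
have bb : balanced (anti t) b.
  split=> [m|n|n m s].
  - by move=> n n'; rewrite /b pl qB.
  - move=> m m'; have [x <-] := p_onto m; have [x' <-] := p_onto m'.
    by rewrite -linearB !bE pr qB.
  - by have [x <-] := p_onto m; rewrite -linearZ !bE pb.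
have [h hB hE] := ten_lift t bb.
have hq : forall u, h (tmapl N p u) = q u.
  apply: ten_ext => // [|n x]; first by apply: additive_comp => //;
    exact: tmapB.
  by rewrite tmapl_pure hE bE.
by move=> pv; apply/qE; rewrite -hq pv (additive0 hB).
Qed.

End Functor.

Arguments tmapl {T S} t N {M M'} f _.
Arguments tmapr {T S} t {N N'} M f _.
Arguments tmapl_onto {T S} t N {X M p}.
Arguments tmapl_exact {T S} t N {K X M i p}.
Arguments tmapl_zero {T S} t N {K X M i p}.
Arguments tmap_lr {T S} t {N N' M M'} g f u.

Section DiagramChase.
Variables (T S : pzRingType) (t : tensor_theory T S).
Lemma tmapr_zero (M : lmodType S) (L P N : lmodType T) (i : {linear L -> P})
    (p : {linear P -> N}) :
  (forall k, p (i k) = 0) -> forall u, tmapr t M p (tmapr t M i u) = 0.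
Proof. exact: (@tmapl_zero _ _ (flip t)). Qed.

Lemma tmapr_exact (M : lmodType S) (L P N : lmodType T) (i : {linear L -> P})
    (p : {linear P -> N}) :
  exact_at i p -> onto p -> exact_at (tmapr t M i) (tmapr t M p).
Proof. exact: (@tmapl_exact _ _ (flip t)). Qed.

Lemma tmaplB (N : lmodType T) (M M' : lmodType S) (f : {linear M -> M'}) :
  additive_map (tmapl t N f).
Proof. exact: tmapB. Qed.
Lemma tmaprB (M : lmodType S) (N N' : lmodType T) (f : {linear N -> N'}) :
  additive_map (tmapr t M f).
Proof. exact: tmapB. Qed.

Lemma ses_zero (R : pzRingType) (K X M : lmodType R) (i : {linear K -> X})
  (p : {linear X -> M}) : ses i p -> forall k, p (i k) = 0.
Proof. by case=> _ ip _ k; apply/ip; exists k. Qed.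

Arguments tmaplB N {M M'} f.
Arguments tmaprB M {N N'} f.
Arguments tmapr_exact M {L P N i p}.
Arguments tmapr_zero M {L P N i p}.
Section Chase.
Variables (L P N : lmodType T) (a : {linear L -> P}) (b : {linear P -> N}).
Variables (K G M : lmodType S) (i : {linear K -> G}) (p : {linear G -> M}).
Hypotheses (ab : ses a b) (ip : ses i p).

(** Tensoring the two short exact sequences gives a commutative 3 x 3 diagram
    with right exact rows and columns.  An element of L (x) M that dies in
    P (x) M is lifted to L (x) G, moved to P (x) G, pulled back to P (x) K and
    finally to L (x) K by injectivity of N (x) i.  Applied to the flipped tensor
    product, the statement exchanges the two sequences. *)
Lemma chase : injective (tmapl t N i) -> injective (tmapr t G a) ->
  injective (tmapr t M a).
Proof.
move=> iN aG; have [a_inj ab_ex b_onto] := ab; have [i_inj ip_ex p_onto] := ip.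
apply: additive_inj => [|l al0]; first exact: tmaprB.
have [l' l'E] := tmapl_onto t L p_onto l.
have [k kE] : exists k, tmapl t P i k = tmapr t G a l'.
  by apply/(tmapl_exact t P ip_ex p_onto); rewrite tmap_lr l'E.
have [k' k'E] : exists k', tmapr t K a k' = k.
  apply/(tmapr_exact K ab_ex b_onto); apply: iN.
  rewrite tmap_lr kE tmapr_zero; last exact: ses_zero ab.
  by rewrite (additive0 (tmaplB _ _)).
rewrite -l'E -(_ : tmapl t L i k' = l') ?tmapl_zero //;
  first exact: ses_zero ip.
by apply: aG; rewrite -tmap_lr k'E.
Qed.
End Chase.
End DiagramChase.
Arguments tmaplB {T S} t N {M M'} f.
Arguments tmaprB {T S} t M {N N'} f.
Arguments tmapr_exact {T S} t M {L P N i p}.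
Arguments tmapr_zero {T S} t M {L P N i p}.

(** Vanishing of Tor_1(N, M).  For one sequence with [X] flat this is the usual
    description of Tor_1 as the kernel of N (x) K -> N (x) X; asking it of all
    sequences ending in [M] avoids the choice of a resolution, and by
    [tor_zero_coker] one sequence with [X] flat suffices. *)
Definition tor_zero (T S : pzRingType) (t : tensor_theory T S)
    (N : lmodType T) (M : lmodType S) : Prop :=
  forall (K X : lmodType S) (i : {linear K -> X}) (p : {linear X -> M}),
    ses i p -> injective (tmapl t N i).

Definition flat (T S : pzRingType) (t : tensor_theory T S)
    (M : lmodType S) : Prop :=
  forall (A B C : lmodType T) (f : {linear A -> B}) (g : {linear B -> C}),
    exact_at f g -> exact_at (tmapr t M f) (tmapr t M g).

Section FreeFlat.
Variables (T S : pzRingType) (t : tensor_theory T S) (X : choiceType).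

Let eval_form (N : lmodType T) (n : N) (f : free_mod S X) : X -> N :=
  fun x => anti t (coef f x) *: n.

Let eval_balanced N : balanced (anti t) (@eval_form N).
Proof.
split=> [f|n|n f s]; rewrite /eval_form.
- by move=> n n'; apply/funext => x; rewrite scalerBr.
- move=> f g; apply/funext => x.
  by rewrite coefB (antiB t) scalerBl.
- by apply/funext => x; rewrite scalerA -antiM coefZ.
Qed.

(** N (x) free(X) is the group of finitely supported functions from [X] to [N]:
    sending n (x) f to the function x |-> f(x) n is natural in [N], and it is
    injective because every tensor is a sum of tensors c(x) (x) e_x over
    distinct basis elements. *)
Lemma free_tensor_inj (N N' : lmodType T) (a : {linear N -> N'}) :
  injective a -> injective (tmapr t (free_mod S X) a).
Proof.
move=> a_inj; apply: additive_inj => [|u au0]; first exact: tmaprB.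
have [h hB hE] := ten_lift t (@eval_balanced N).
have [h' h'B h'E] := ten_lift t (@eval_balanced N').
have nat : forall u, h' (tmapr t _ a u) = fun x => a (h u x).
  apply: ten_ext => [||n f].
  - by apply: additive_comp => //; exact: tmaprB.
  - by move=> v w; rewrite hB; apply/funext => x; exact: linearB.
  - rewrite tmapr_pure h'E hE; apply/funext => x.
    by rewrite /eval_form linearZ.
have hu0 x : h u x = 0.
  have /(congr1 (fun F => F x)) := nat u; rewrite au0 (additive0 h'B) =>
    /esym ax0.
  by apply: a_inj; rewrite ax0 linear0.
have [pl pr pb] := pure_balanced t N (free_mod S X).
suff [s [_ sE]] : exists s, uniq s /\ forall r, uniq r -> {subset s <= r} ->
    u = \sum_(x <- r) pure t (h u x) (basis S x).
  rewrite (sE (undup s)) ?undup_uniq // => [|x]; last by rewrite mem_undup.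
  by rewrite big1 // => x _; rewrite hu0; exact: additive0 (pl _).
move: u {au0 hu0}; apply: (ten_ind t) => [|u v [s [us sE]] [s' [us' sE']]|n f].
- exists [::]; split=> // r _ _; rewrite big1 // => x _.
  by rewrite (additive0 hB); exact: additive0 (pl _).
- exists (undup (s ++ s')); split=> [|r ur sr]; first exact: undup_uniq.
  rewrite {1}(sE r) // => [|x xs]; last by apply: sr;
    rewrite mem_undup mem_cat xs.
  rewrite {1}(sE' r) // => [|x xs]; last by apply: sr;
    rewrite mem_undup mem_cat xs orbT.
  by rewrite -sumrB; apply: eq_bigr => x _; rewrite hB pl.
- have [s sf] := covered f; exists s; split=> [|r ur sr]; first by case: sf.
  rewrite {1}(free_sum (covers_super sf ur sr)).
  have -> (F : X -> free_mod S X) : pure t n (\sum_(x <- r) F x)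
    = \sum_(x <- r) pure t n (F x).
    by elim/big_rec2: _ => [|x v w _ <-]; rewrite ?(additive0 (pr n))
      ?(additiveD (pr n)).
  by apply: eq_bigr => x _; rewrite -pb hE.
Qed.
End FreeFlat.

Section TorZero.
Variables (T S : pzRingType) (t : tensor_theory T S).

Lemma free_tor_zero (X : choiceType) (N : lmodType T) : tor_zero (flip t)
    (free_mod S X) N.
Proof. by move=> L Y a b [a_inj _ _]; exact: (free_tensor_inj (t := t)). Qed.

(** Balance of Tor: vanishing may be tested with sequences ending in either
    argument. *)
Lemma tor_sym (N : lmodType T) (M : lmodType S) : tor_zero t N M ->
    tor_zero (flip t) M N.
Proof.
move=> NM L Y a b ab; apply: (chase (t := t) ab (Omega_ses M)).
  exact: NM (Omega_ses M).
exact: free_tor_zero ab.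
Qed.
End TorZero.

Section DimensionShift.
Variables (T S : pzRingType) (t : tensor_theory T S).

Lemma tor_sym_flip (N : lmodType T) (M : lmodType S) : tor_zero (flip t)
    M N -> tor_zero t N M.
Proof. exact: (@tor_sym _ _ (flip t)). Qed.

(** Preservation of injections suffices for flatness: for exact A -> B -> C,
    the cokernel of A -> B embeds into C, and tensoring is right exact. *)
Lemma flatP (M : lmodType S) : flat t M <-> forall N, tor_zero t N M.
Proof.
split=> [flatM N|torM A B C f g fg].
  apply: tor_sym_flip => L Y a b [a_inj _ _]; apply: additive_inj => [|v av].
    exact: (tmaprB t M a).
  have z_lin : linear (fun _ : L => 0 : L) by move=> c x y;
    rewrite scaler0 addr0.
  have za : exact_at (mk_linear z_lin) a.
    move=> x; split=> [ax|[y <-]]; last exact: linear0.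
    by exists 0; apply: a_inj; rewrite ax linear0.
  have [u <-] := (flatM _ _ _ _ _ za v).1 av.
  have z0 : forall u, tmapr t M (mk_linear z_lin) u = 0.
    apply: ten_ext => [||n m]; first exact: tmaprB.
      by move=> x y; rewrite subrr.
    rewrite tmapr_pure /=; have [pl _ _] := pure_balanced t L M;
      exact: additive0 (pl m).
  exact: z0.
have gf0 x : g (f x) = 0 by apply/fg; exists x.
have [h hE] : exists h : {linear coker f -> C}, forall x, h (coker_pi f x)
  = g x.
  apply: descend => [|x /coker_exact[y <-]]; [exact: coker_onto | exact: gf0].
have h_inj : injective h.
  apply: linear_inj => y; have [x <-] := coker_onto y; rewrite hE => /fg fx.
  exact/coker_exact.
have hM : injective (tmapr t M h) := tor_sym (torM (coker h)) (coker_ses h_inj).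
move=> v; split=> [gv|[u <-]]; last exact: tmapr_zero.
apply/(tmapr_exact t M (@coker_exact _ _ _ f) (@coker_onto _ _ _ f)).
apply: hM; rewrite (additive0 (tmaprB t M h)) -gv.
by apply: tmap_comp.
Qed.

(** The exact sequence Tor_1(N, G) -> Tor_1(N, M) -> N (x) K -> N (x) G. *)
Lemma tor_zero_coker (N : lmodType T) (K G M : lmodType S) (i : {linear K -> G})
    (p : {linear G -> M}) :
  ses i p -> tor_zero t N G -> injective (tmapl t N i) -> tor_zero t N M.
Proof.
move=> ip NG iN; apply: tor_sym_flip => L P a b ab.
apply: (chase (t := t) ab ip iN); exact: (tor_sym NG ab).
Qed.

(** Dimension shifting, with Tor_1(L, M) in the role of Tor_2(N, M): the exact
    sequence Tor_2(N, G) -> Tor_2(N, M) -> Tor_1(N, K) has vanishing outer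
    terms.  Concretely, L (x) K -> P (x) K -> P (x) G is injective and factors
    through L (x) G. *)
Lemma tor_shift (L P N : lmodType T) (a : {linear L -> P}) (b : {linear P -> N})
    (K G M : lmodType S) (i : {linear K -> G}) (p : {linear G -> M}) :
  ses a b -> ses i p -> (forall X, tor_zero t P X) ->
  tor_zero t L G -> tor_zero t N K -> tor_zero t L M.
Proof.
move=> ab ip Pflat LG NK; apply: (tor_zero_coker ip LG).
have aK := tor_sym NK ab; have iP := Pflat _ _ _ _ _ ip.
move=> x y xy; apply: aK; apply: iP; move: (tmap_lr t a i).
by rewrite /= => lr; rewrite [LHS]lr [RHS]lr xy.
Qed.
End DimensionShift.

Section Syzygy.
Variables (T S : pzRingType) (t : tensor_theory T S).

Lemma tor_zero_free (X : choiceType) (N : lmodType T) :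
    tor_zero t N (free_mod S X).
Proof. exact/tor_sym_flip/free_tor_zero. Qed.
Lemma tor_free_zero (X : choiceType) (M : lmodType S) :
    tor_zero t (free_mod T X) M.
Proof. exact: (@free_tor_zero _ _ (flip t)). Qed.

(** Both sides say that Tor_2(N, M) vanishes. *)
Lemma tor_Omega (N : lmodType T) (M : lmodType S) :
  tor_zero t N (Omega M) <-> tor_zero t (Omega N) M.
Proof.
split=> H; last apply: tor_sym_flip.
  by apply: tor_shift (Omega_ses N) (Omega_ses M) _ _ H => *;
    [exact: tor_free_zero | exact: tor_zero_free].
apply: (tor_shift (t := flip t) (Omega_ses M) (Omega_ses N)) => *.
- exact: free_tor_zero.
- by apply: tor_sym; exact: tor_free_zero.
- exact: tor_sym.
Qed.

Lemma tor_Omega_iter k (N : lmodType T) (M : lmodType S) :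
  tor_zero t N (iter k (@Omega S) M) <-> tor_zero t (iter k (@Omega T) N) M.
Proof.
elim: k N M => //= k IH N M; rewrite tor_Omega IH -iterSr //.
Qed.
End Syzygy.

(** * Resolutions and flat dimension *)

Section Resolutions.
Variables (R : pzRingType) (C : lmodType R -> Prop).

Definition zero_mod : lmodType R := 'rV[R]_0.
Lemma zero_modP : zero_module zero_mod.
Proof. by move=> x; apply/matrixP => i []. Qed.

Definition of_zero (M : lmodType R) : {linear zero_mod -> M}.
Proof. by apply: (@mk_linear _ _ _ (fun=> 0)) => a x y;
  rewrite scaler0 addr0. Defined.

Lemma resolution_self (M : lmodType R) : C M -> has_resolution_of_length C M 0.
Proof.
move=> CM.
pose obj i : lmodType R := if i is _.+1 then zero_mod else M.
pose d i : {linear obj i.+1 -> obj i} := of_zero (obj i).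
exists (@Augmented R M obj d idfun); split=> /=.
- split=> [x|x|i x] /=; first by exists x.
    split=> [->|[_ <-]] //; by exists 0.
  by split=> // _; exists 0; rewrite (zero_modP x).
- by case.
- by case=> // i _; exact: zero_modP.
Qed.

Lemma resolution_cons (K G M : lmodType R) (i : {linear K -> G})
    (p : {linear G -> M}) k :
  ses i p -> C G -> has_resolution_of_length C K k ->
    has_resolution_of_length C M k.+1.
Proof.
move=> [i_inj ip p_onto] CG [X [[e_onto de dd] XC X0]].
pose obj j : lmodType R := if j is j'.+1 then aug_obj X j' else G.
pose d j : {linear obj j.+1 -> obj j} :=
  match j with 0 => i \o aug_eps X | j'.+1 => aug_d X j' end.
exists (@Augmented R M obj d p); split=> /=.
- split=> // [x|[|j]] /=; last exact: dd.
    rewrite (ip x); split=> [[u <-]|[u <-]]; last by exists (aug_eps X u).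
    by have [w <-] := e_onto u; exists w.
  move=> x /=; rewrite -(de x); split=> [ix0|->]; last exact: linear0.
  by apply: i_inj; rewrite ix0 linear0.
- by case=> // j jk; exact: XC.
- by case=> // j jk; exact: X0.
Qed.

Definition aug_shift (M : lmodType R) (X : augmented M)
    (e : {linear aug_obj X 1 -> ker (aug_eps X)}) :
    augmented (ker (aug_eps X)) :=
  @Augmented R (ker (aug_eps X)) (fun i => aug_obj X i.+1) (fun i =>
    aug_d X i.+1) e.

Lemma resolution_shift (M : lmodType R) (X : augmented M) : resolution X ->
  exists2 e, resolution (aug_shift e) & forall x, ker_in _ (e x) = aug_d X 0 x.
Proof.
move=> [e_onto de dd]; have [k_inj kP _] := ker_ses e_onto.
have [e eE] : exists e : {linear aug_obj X 1 -> ker (aug_eps X)},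
    forall x, ker_in _ (e x) = aug_d X 0 x.
  by apply: corestrict => // u; apply/kP/de; exists u.
exists e => //; split=> //= [y|x].
  have /de[x xE] : aug_eps X (ker_in _ y) = 0 by apply/kP; exists y.
  by exists x; apply: k_inj; rewrite eE.
rewrite -(dd 0 x) -eE; split=> [->|ex0]; first exact: linear0.
by apply: k_inj; rewrite ex0 linear0.
Qed.

Lemma resolution0_iso (M : lmodType R) : has_resolution_of_length C M 0 ->
  exists (G : lmodType R) (f : {linear G -> M}), [/\ C G, injective f & onto f].
Proof.
case=> X [[e_onto de _] XC X0]; exists (aug_obj X 0), (aug_eps X); split=> //;
  first exact: XC.
apply: linear_inj => x /de[u <-]; by rewrite (X0 1 _ u) // linear0.
Qed.

Lemma resolution_uncons (M : lmodType R) k : has_resolution_of_length C M k.+1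
    ->
  exists (K G : lmodType R) (i : {linear K -> G}) (p : {linear G -> M}),
    [/\ ses i p, C G & has_resolution_of_length C K k].
Proof.
case=> X [resX XC X0]; have [e rese _] := resolution_shift resX.
exists (ker (aug_eps X)), (aug_obj X 0), (ker_in _), (aug_eps X); split.
- by apply: ker_ses; case: resX.
- exact: XC.
- by exists (aug_shift e); split=> // i; [exact: (XC i.+1) | exact: (X0 i.+1)].
Qed.

Lemma resolution_Omega k (M : lmodType R) :
    (forall X : choiceType, C (free_mod R X)) ->
  C (iter k (@Omega R) M) -> has_resolution_of_length C M k.
Proof.
move=> Cfree; elim: k M => [|k IH] M; first exact: resolution_self.
rewrite iterSr => CM; apply: resolution_cons (Omega_ses M) (Cfree _) _;
  exact: IH.
Qed.

End Resolutions.

Section Dimension.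
Variables (T S : pzRingType) (t : tensor_theory T S).

Lemma tor_zero_iso (N : lmodType T) (G M : lmodType S) (f : {linear G -> M}) :
  injective f -> onto f -> tor_zero t N G -> tor_zero t N M.
Proof.
move=> f_inj f_onto NG K X i p [i_inj ip p_onto].
have [g gE] : exists g : {linear X -> G}, forall x, f (g x) = p x.
  by apply: corestrict => // x; exact: f_onto.
apply: (NG _ _ i g); split=> // [x|y].
  rewrite -(ip x) -gE; split=> [->|fg0]; first exact: linear0.
  by apply: f_inj; rewrite fg0 linear0.
by have [x xE] := p_onto (f y); exists x; apply: f_inj; rewrite gE.
Qed.

(** If Tor_i(N, -) vanishes on [C] for all i > 0, then Tor_i(N, M) vanishes for
    i > k as soon as [M] has a [C]-resolution of length [k]. *)
Lemma tor_resolution (C : lmodType S -> Prop) (N : lmodType T) :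
  (forall G, C G -> forall j, tor_zero t (iter j (@Omega T) N) G) ->
  forall k M, has_resolution_of_length C M k ->
  forall j, (k <= j)%N -> tor_zero t (iter j (@Omega T) N) M.
Proof.
move=> CN; elim=> [|k IH] M.
  move=> /resolution0_iso[G [f [CG f_inj f_onto]]] j _.
  by apply: tor_zero_iso f_inj f_onto _; exact: CN.
move=> /resolution_uncons[K [G [i [p [ip CG resK]]]]] [//|j] kj.
apply: (tor_shift (Omega_ses _) ip) => [X||].
- exact: tor_free_zero.
- exact: (CN _ CG j.+1).
- exact: IH.
Qed.

Lemma flat_free (X : choiceType) : flat t (free_mod S X).
Proof. by apply/flatP => N; exact: tor_zero_free. Qed.

Lemma tor_flat_resolution k (M : lmodType S) :
    has_resolution_of_length (flat t) M k ->
  forall j, (k <= j)%N -> forall N, tor_zero t (iter j (@Omega T) N) M.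
Proof.
move=> resM j kj N; apply: (@tor_resolution (flat t) N) kj =>
  // G /flatP flG i; exact: flG.
Qed.

(** The hypothesis is Tor_(k+1)(-, M) = 0, which makes the [k]-th syzygy of [M]
    flat. *)
Lemma flat_resolution k (M : lmodType S) :
  (forall N, tor_zero t (iter k (@Omega T) N) M) ->
    has_resolution_of_length (flat t) M k.
Proof.
move=> torM; apply: resolution_Omega; first exact: flat_free.
by apply/flatP => N; apply/tor_Omega_iter.
Qed.

(** Exactness of Tor_1(N, A) -> Tor_1(N, M) -> Tor_1(N, B), in its weak form
    about vanishing. *)
Lemma tor_extension (N : lmodType T) (A M B : lmodType S)
    (i : {linear A -> M}) (p : {linear M -> B}) :
  ses i p -> tor_zero t N A -> tor_zero t N B -> tor_zero t N M.
Proof.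
move=> ip NA NB; have [i_inj ip_ex p_onto] := ip.
have ab := Omega_ses N; apply: tor_sym_flip.
apply: (@tor_zero_coker _ _ (flip t) _ _ _ _ _ _ ab); first by apply: tor_sym;
  exact: tor_free_zero.
set a := ker_in _ in ab *.
have aA : injective (tmapr t A a) := tor_sym NA ab.
have aB : injective (tmapr t B a) := tor_sym NB ab.
have iP := @tor_free_zero _ _ t N _ _ _ _ _ ip.
apply: additive_inj => [|l al]; first exact: (tmaprB t M a).
have [u uE] : exists u, tmapl t _ i u = l.
  apply/(tmapl_exact t _ ip_ex p_onto)/aB.
  rewrite -tmap_lr [X in tmapl _ _ _ X]al (additive0 (tmaprB _ _ _)).
  exact: additive0 (tmaplB _ _ _).
rewrite -uE -(_ : 0 = u) ?(additive0 (tmaplB _ _ _)) //.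
apply/aA/iP; rewrite (additive0 (tmaprB _ _ _)) (additive0 (tmaplB _ _ _))
  tmap_lr uE.
by symmetry.
Qed.

Lemma ses_sum (R : pzRingType) (A B : lmodType R) :
  exists (i : {linear A -> (A * B)%type}) (p : {linear (A * B)%type -> B}),
    ses i p.
Proof.
have i_lin : linear (fun x : A => (x, 0 : B)).
  by move=> a x y; congr pair => /=; rewrite scaler0 addr0.
have p_lin : linear (fun u : A * B => u.2) by [].
exists (mk_linear i_lin), (mk_linear p_lin); split=> [x y [] //|[x y]|y].
  by split=> /= [->|[u [_ <-]] //]; exists x.
by exists (0, y).
Qed.

Lemma tor_sum (N : lmodType T) (A B : lmodType S) :
  tor_zero t N A -> tor_zero t N B -> tor_zero t N (A * B)%type.
Proof. by have [i [p ip]] := @ses_sum S A B; exact: tor_extension ip. Qed.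

(** Lifting the free cover of [C] through [p] gives a surjection from
    free(M) (+) free(C) onto [E], which is compatible with the covers of [M] and
    [C]; its kernel [Q] is a syzygy of [E], though not the canonical one.  The
    last clause records the part of this that matters later: Tor_1(-, Q) is a
    Tor_2(-, E). *)
Lemma horseshoe (M E C : lmodType S) (i : {linear M -> E})
    (p : {linear E -> C}) :
  ses i p -> exists (Q : lmodType S) (i' : {linear Omega M -> Q})
    (p' : {linear Q -> Omega C}),
    ses i' p' /\ forall N, tor_zero t (Omega N) E -> tor_zero t N Q.
Proof.
move=> ip; have pi0 := ses_zero ip; have [i_inj ip_ex p_onto] := ip.
pose s : {linear free_mod S C -> E} := free_lift (fun c =>
  sval (cid (p_onto c))).
have sE y : p (s y) = cover C y.
  apply: (free_lift_unique (f := p \o s)) => c.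
  by rewrite cover_basis -[LHS]/(p (s _)) free_lift_basis; case: cid.
have q_lin : linear (fun u : free_mod S M * free_mod S C =>
  i (cover M u.1) + s u.2).
  move=> a u v; rewrite -[(a *: u + v).1]/(a *: u.1 + v.1)
    -[(a *: u + v).2]/(a *: u.2 + v.2).
  by rewrite !linearP scalerDr addrACA.
pose q := mk_linear q_lin.
have qE u : q u = i (cover M u.1) + s u.2 by [].
have q_onto : onto q.
  move=> e; have [y yE] := cover_onto (p e).
  have [m mE] : exists m, i m = e - s y by apply/ip_ex;
    rewrite linearB sE yE subrr.
  by have [x xE] := cover_onto m; exists (x, y); rewrite qE xE mE subrK.
have [k_inj kP _] := ker_ses q_onto.
have [M_inj MP _] := Omega_ses M; have [C_inj CP _] := Omega_ses C.
have j_lin : linear (fun x : Omega M => (ker_in _ x, 0) :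
  (free_mod S M * free_mod S C)%type).
  by move=> a x y; rewrite linearP; congr pair => /=; rewrite scaler0 addr0.
have [i' i'E] : exists i' : {linear Omega M -> ker q},
    forall x, ker_in q (i' x) = (ker_in _ x, 0).
  apply: (corestrict (f := mk_linear j_lin)) => // x; apply/kP;
    rewrite qE linear0 addr0.
  by rewrite (ses_zero (Omega_ses M)) linear0.
have pr_lin : linear (fun u : ker q => (ker_in q u).2) by move=> a x y;
  rewrite linearP.
have qk := ses_zero (ker_ses q_onto).
have [p' p'E] : exists p' : {linear ker q -> Omega C},
    forall u, ker_in _ (p' u) = (ker_in q u).2.
  apply: (corestrict (f := mk_linear pr_lin)) => // u; apply/CP;
    rewrite -[mk_linear _ _]/(ker_in q u).2 -sE.
  have := congr1 p (qk u); rewrite qE linearD pi0 add0r linear0 //.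
exists (ker q), i', p'; split; first split.
- by move=> x y /(congr1 (ker_in q)); rewrite !i'E => -[] /M_inj.
- move=> u; split=> [p'u|[x <-]].
    have u2 : (ker_in q u).2 = 0 by rewrite -[LHS]p'E p'u linear0.
    have /MP[x xE] : cover M (ker_in q u).1 = 0.
      by apply: i_inj; rewrite linear0 -(qk u) qE u2 linear0 addr0.
    exists x; apply: k_inj; rewrite i'E xE -u2; by case: (ker_in q u).
  by apply: C_inj; rewrite p'E i'E linear0.
- move=> y; have [m mE] : exists m, i m = s (ker_in _ y).
    by apply/ip_ex; rewrite sE (ses_zero (Omega_ses C)).
  have [x xE] := cover_onto m.
  have /kP[u uE] : q (- x, ker_in _ y) = 0 by rewrite qE !linearN xE mE addNr.
  by exists u; apply: C_inj; rewrite p'E uE.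
move=> N NE; apply: tor_sym_flip.
apply: (tor_shift (t := flip t) (ker_ses q_onto) (Omega_ses N)) => [X||].
- by apply: tor_sym; apply: tor_sum; exact: tor_zero_free.
- by apply: tor_sym; exact: tor_free_zero.
- exact: tor_sym.
Qed.

Lemma horseshoe_iter k (M E C : lmodType S) (i : {linear M -> E})
    (p : {linear E -> C}) :
  ses i p -> exists (Q : lmodType S) (i' : {linear iter k (@Omega S) M -> Q})
    (p' : {linear Q -> iter k (@Omega S) C}),
    ses i' p' /\ forall N, tor_zero t (iter k (@Omega T) N) E -> tor_zero t N Q.
Proof.
elim: k M E C i p => [|k IH] M E C i p ip; first by exists E, i, p.
have [E' [i' [p' [ip' EE']]]] := horseshoe ip.
rewrite !iterSr; have [Q [j [r [jr E'Q]]]] := IH _ _ _ _ _ ip'.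
by exists Q, j, r; split=> // N NE; apply: E'Q; exact: EE'.
Qed.

End Dimension.

(** * Gorenstein flat modules relative to a class *)

(** Two short exact sequences glued at their common term. *)
Lemma splice_exact (A Z F Z' H : zmodType) (p' : A -> Z) (i' : Z -> F)
    (p : F -> Z') (i : Z' -> H) (d' : A -> F) (d : F -> H) :
  onto p' -> exact_at i' p -> injective i -> additive_map i ->
  (forall x, d' x = i' (p' x)) -> (forall x, d x = i (p x)) -> exact_at d' d.
Proof.
move=> p'_onto ip i_inj iB d'E dE x; rewrite dE.
have -> : (i (p x) = 0) = (p x = 0).
  apply/propext; split=> [ip0|->]; last exact: additive0.
  by apply: i_inj; rewrite ip0 additive0.
rewrite (ip x); split=> [[z <-]|[a <-]]; last by exists (p' a).
by have [a <-] := p'_onto z; exists a.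
Qed.

Section GF.
Variables (T S : pzRingType) (t : tensor_theory T S).

Lemma tmapl_comp (N : lmodType T) (U V W : lmodType S) (f : {linear U -> V})
    (g : {linear V -> W}) (h : {linear U -> W}) :
  (forall x, g (f x) = h x) ->
  forall u, tmapl t N h u = tmapl t N g (tmapl t N f u).
Proof. by move=> gf u; symmetry; apply: tmap_comp. Qed.

(** A flat resolution of [G] that stays exact under N (x) - computes Tor, so all
    Tor_i(N, G) with i > 0 vanish.  The induction replaces [G] by
    the first syzygy in [X]. *)
Lemma tor_flat_complex (N : lmodType T) j (G : lmodType S) (X : augmented G) :
  resolution X -> (forall i, flat t (aug_obj X i)) ->
  (forall i, exact_at (tmapl t N (aug_d X i.+1)) (tmapl t N (aug_d X i))) ->
  tor_zero t (iter j (@Omega T) N) G.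
Proof.
elim: j G X => [|j IH] G X resX flX exX;
    have [e rese eE] := resolution_shift resX;
    have [e_onto _ _] := resX; have kses := ker_ses e_onto.
  apply: (tor_zero_coker kses) => /=; first by move/flatP: (flX 0); exact.
  have [d_onto dd _] := rese.
  apply: additive_inj => [|z]; first exact: tmaplB.
  have [y <-] := tmapl_onto t N d_onto z.
  rewrite -(tmapl_comp eE) => /exX[w <-]; apply: tmapl_zero => x.
  by apply/dd; exists x.
apply: (tor_shift (Omega_ses _) kses) => [Y||].
- exact: tor_free_zero.
- by move/flatP: (flX 0); exact.
- by apply: (IH _ (aug_shift e)) => // i; [exact: (flX i.+1)
  | exact: (exX i.+1)].
Qed.

Variable B : lmodType T -> Prop.

(** The common form of the two classes GF_B: the tensor product [t] decides
    which of the two sides the modules are on. *)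
Definition GF (G : lmodType S) : Prop :=
  exists X : two_sided S,
    [/\ forall i, flat t (lo X i) /\ flat t (up X i), exact_complex X,
        forall N, B N ->
          exact_two_sided (fun i => tmapl t N (lo_d X i))
            (tmapl t N (mid_d X))
            (fun i => tmapl t N (up_d X i))
      & is_kernel G (up_d X 0)].

(** The left half of the complex defining [G] is a flat resolution of [G] to
    which [tor_flat_complex] applies. *)
Lemma tor_GF (G : lmodType S) (N : lmodType T) : GF G -> B N ->
  forall j, tor_zero t (iter j (@Omega T) N) G.
Proof.
move=> [X [flX [dd d0 dm _] exN [iota [iota_inj iotaE]]]] BN j.
have [e eE] : exists e : {linear lo X 0 -> G}, forall x, iota (e x) = mid_d X x.
  by apply: corestrict => // u; apply/iotaE/dm; exists u.
have [ddN _ _ _] := exN N BN.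
apply: (@tor_flat_complex N j G (@Augmented S G (lo X) (lo_d X) e)) => //=;
  last first.
  by move=> i; case: (flX i).
split=> //= [g|x].
  have /dm[x xE] : up_d X 0 (iota g) = 0 by apply/iotaE; exists g.
  by exists x; apply: iota_inj; rewrite eE.
rewrite -(d0 x) -eE; split=> [->|ex0]; first exact: linear0.
by apply: iota_inj; rewrite ex0 linear0.
Qed.

(** One step of a coresolution, with the next module in the same class [K]:
    the steps chosen for all members of [K] can then be iterated. *)
Record flat_ext (K : lmodType S -> Prop) (x : {M | K M}) := FlatExt {
  ext_next : {M | K M};
  ext_mid : lmodType S;
  ext_in : {linear sval x -> ext_mid};
  ext_out : {linear ext_mid -> sval ext_next};
  ext_ses : ses ext_in ext_out;
  ext_flat : flat t ext_mid }.

(** Coinductive principle for GF_B.  Splicing the sequences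
    0 -> M -> Q -> M' -> 0 gives the right half of the complex, a free
    resolution of [M] its left half.
    Both halves are assembled from short exact sequences whose last terms [Z]
    satisfy Tor_1(N, Z) = 0 for [N] in [B], so they stay exact under
    N (x) -. *)
Lemma GF_coind (K : lmodType S -> Prop) :
  (forall M, K M -> forall N, B N ->
    forall j, tor_zero t (iter j (@Omega T) N) M) ->
  (forall M, K M -> exists (Q M' : lmodType S) (i : {linear M -> Q})
    (p : {linear Q -> M'}), [/\ ses i p, flat t Q & K M']) ->
  forall M, K M -> GF M.
Proof.
move=> torK extK M KM.
have ext (x : {M | K M}) : inhabited (flat_ext x).
  case: x => L KL; have [Q [M' [i [p [ip flQ KM']]]]] := extK L KL.
  by exists; exact: (@FlatExt K (exist _ L KL) (exist _ M' KM') Q i p ip flQ).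
pose E x := inhabited_witness (ext x).
pose Y i := iter i (fun x => ext_next (E x)) (exist _ M KM).
pose Z i := iter i (@Omega S) M.
pose lod i : {linear free_mod S (Z i.+1) -> free_mod S (Z i)} :=
  ker_in (cover (Z i)) \o cover (Z i.+1).
pose mid : {linear free_mod S (Z 0%N) -> ext_mid (E (Y 0%N))} :=
  ext_in (E (Y 0%N)) \o cover (Z 0%N).
pose upd i : {linear ext_mid (E (Y i)) -> ext_mid (E (Y i.+1))} :=
  ext_in (E (Y i.+1)) \o ext_out (E (Y i)).
pose X := @TwoSided S (fun i => free_mod S (Z i)) (fun i => ext_mid (E (Y i)))
  lod mid upd.
have sesY i := ext_ses (E (Y i)).
have Omega_onto i : onto (cover (Z i)) by exact: cover_onto.
have OmegaZ i : ses (ker_in (cover (Z i))) (cover (Z i)) by exact: Omega_ses.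
have spl (A L U L' H : lmodType S) (p' : {linear A -> L}) (i : {linear L -> U})
    (p : {linear U -> L'}) (i' : {linear L' -> H}) :
    onto p' -> ses i p -> injective i' -> exact_at (i \o p') (i' \o p).
  move=> p'_onto [_ ip _] i'_inj; apply: (splice_exact p'_onto ip i'_inj) =>
    // x y.
  by rewrite linearB.
have tspl N (A L U L' H : lmodType S) (p' : {linear A -> L})
    (i : {linear L -> U}) (p : {linear U -> L'}) (i' : {linear L' -> H}) :
    onto p' -> ses i p -> injective (tmapl t N i') ->
    exact_at (tmapl t N (i \o p')) (tmapl t N (i' \o p)).
  move=> p'_onto [_ ip p_onto] i'_inj.
  apply: (splice_exact (tmapl_onto t N p'_onto) (tmapl_exact t N ip p_onto)
    i'_inj).
  - exact: tmaplB.
  - exact: tmapl_comp.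
  - exact: tmapl_comp.
have Z_inj i : injective (ker_in (cover (Z i))) by case: (OmegaZ i).
have Y_inj i : injective (ext_in (E (Y i))) by case: (sesY i).
have Y_onto i : onto (ext_out (E (Y i))) by case: (sesY i).
exists X; split.
- by move=> i; split; [exact: flat_free | exact: ext_flat].
- split=> [i||| i].
  + exact: spl (Omega_onto i.+2) (OmegaZ i.+1) (Z_inj i).
  + exact: spl (Omega_onto 1%N) (OmegaZ 0%N) (Y_inj 0%N).
  + exact: spl (Omega_onto 0%N) (sesY 0%N) (Y_inj 1%N).
  + exact: spl (Y_onto i) (sesY i.+1) (Y_inj i.+2).
- move=> N BN.
  have ZN i : injective (tmapl t N (ker_in (cover (Z i)))).
    have torZ : tor_zero t N (Z i) by apply/tor_Omega_iter; exact: torK.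
    exact: torZ (OmegaZ i).
  have YN i : injective (tmapl t N (ext_in (E (Y i)))).
    have torY : tor_zero t N (sval (Y i.+1)) :=
      torK _ (svalP (Y i.+1)) N BN 0%N.
    exact: torY (sesY i).
  split=> [i||| i].
  + exact: tspl (Omega_onto i.+2) (OmegaZ i.+1) (ZN i).
  + exact: tspl (Omega_onto 1%N) (OmegaZ 0%N) (YN 0%N).
  + exact: tspl (Omega_onto 0%N) (sesY 0%N) (YN 1%N).
  + exact: tspl (Y_onto i) (sesY i.+1) (YN i.+2).
- have [i_inj ip _] := sesY 0%N; have [j_inj _ _] := sesY 1%N.
  exists (ext_in (E (Y 0%N))); split=> // x; rewrite -(ip x) /=.
  by split=> [x0|->]; [apply: j_inj; rewrite linear0 | exact: linear0].
Qed.

(** The split sequences 0 -> F -> F (+) F -> F -> 0 make the class of flat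
    modules closed as [GF_coind] requires. *)
Lemma flat_GF (F : lmodType S) : flat t F -> GF F.
Proof.
apply: (@GF_coind (flat t)) => [M /flatP flM N _ j|M flM]; first exact: flM.
have [i [p ip]] := ses_sum M M.
exists (M * M)%type, M, i, p; split=> //.
by move/flatP: flM => torM; apply/flatP => N; exact: tor_sum.
Qed.

Definition dim_le (R : pzRingType) (C : lmodType R -> Prop) (m : nat)
    (M : lmodType R) :=
  exists2 k, (k <= m)%N & has_resolution_of_length C M k.

(** The modules of GF_B are Tor-acyclic for [B], so a GF_B-resolution of [M] of
    length at most [m] gives Tor_(m+1)(N, M) = 0. *)
Lemma flat_dim_of_GF_dim m : (forall M, dim_le GF m M) ->
  forall N, B N -> dim_le (flat (flip t)) m N.
Proof.
move=> dimM N BN; exists m => //; apply: (flat_resolution (t := flip t)) => M.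
apply: tor_sym; apply/tor_Omega_iter; have [k km resM] := dimM M.
by apply: (tor_resolution _ resM km) => G GG; exact: tor_GF.
Qed.

(** The [m]-th syzygies form a class to which [GF_coind] applies: the required
    flat module [Q] is the [m]-th syzygy, given by the horseshoe lemma, of a
    module of [J]. *)
Lemma GF_dim_of_flat_dim (J : lmodType S -> Prop) m :
  (forall M : lmodType S, exists (E : lmodType S) (i : {linear M -> E}),
    J E /\ injective i) ->
  (forall N, B N -> dim_le (flat (flip t)) m N) ->
  (forall E, J E -> dim_le (flat t) m E) ->
  forall M, dim_le GF m M.
Proof.
move=> embed dimN dimE M; exists m => //.
apply: resolution_Omega => [X|]; first exact/flat_GF/flat_free.
apply: (@GF_coind (fun K => exists L, K = iter m (@Omega S) L));
  last by exists M.
  move=> _ [L ->] N BN j; apply/(tor_Omega_iter t j N); rewrite -iterD;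
    apply: tor_sym_flip.
  have [k km resN] := dimN N BN.
  exact: (tor_flat_resolution resN (leq_trans km (leq_addl j m))).
move=> _ [L ->]; have [E [i [JE i_inj]]] := embed L.
have [Q [i' [p' [ip' QE]]]] := horseshoe_iter t m (coker_ses i_inj).
exists Q, (iter m (@Omega S) (coker i)), i', p'; split=> //;
  last by exists (coker i).
apply/flatP => N; apply: QE; have [k km resE] := dimE E JE.
exact: (tor_flat_resolution resE km).
Qed.
End GF.

(** * Extending homomorphisms into divisible groups *)

Lemma int_subgroup (I : int -> Prop) :
  I 0 -> (forall x y, I x -> I y -> I (x - y)) ->
  exists n : nat, forall z, I z <-> exists q : int, z = q * n%:Z.
Proof.
move=> I0 IB; have IN x : I x -> I (- x) by move=> Ix; rewrite -sub0r;
  exact: IB.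
have IM (q : int) x : I x -> I (q * x).
  move=> Ix; have IMn (k : nat) : I (k%:Z * x).
    elim: k => [|k IH]; first by rewrite mul0r.
    by rewrite -addn1 PoszD mulrDl mul1r -[x in X in _ + X]opprK; exact/IB/IN.
  by case: q => k; rewrite ?NegzE ?mulNr; [exact: IMn | exact/IN/IMn].
have [ex|nex] := pselect (exists n : nat, `[< (0 < n)%N /\ I n%:Z >]);
  last first.
  exists 0%N => z; split=> [Iz|[q ->]]; last by rewrite mulr0.
  exists 0; rewrite mul0r; apply: contrapT => /eqP z0; apply: nex.
  exists `|z|%N; apply/asboolP; split; first by rewrite absz_gt0.
  by rewrite abszE; case: (ger0P z) => _ //; exact: IN.
case: (ex_minnP ex) => n /asboolP[n0 In] nmin; exists n => z.
split=> [Iz|[q ->]]; last exact: IM.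
exists (z %/ n)%Z; have modE : (z %% n)%Z = z - (z %/ n)%Z * n by rewrite /modz.
have Imod : I (z %% n)%Z by rewrite modE; apply: IB => //; exact: IM.
have nZ : (0 < n%:Z)%R by [].
have mod_ge0 : 0 <= (z %% n)%Z by apply: modz_ge0; rewrite lt0r_neq0.
have mod_lt : (z %% n)%Z < n by exact: ltz_pmod.
suff mod0 : (z %% n)%Z = 0 by rewrite {1}(divz_eq z n) mod0 addr0.
case: (z %% n)%Z Imod mod_ge0 mod_lt => // -[//|k] Ik _ kn.
by move: kn; rewrite ltz_nat ltnNge => /negP[]; exact/nmin/asboolP.
Qed.

Section HomExtension.
Variables (A : zmodType) (D : zmodType).
Hypothesis D_div : forall (n : nat) (d : D), (0 < n)%N ->
  exists d', d' *+ n = d.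

(** The graph of a homomorphism from a subgroup of [A] to [D]. *)
Definition partial_hom (G : set (A * D)) : Prop :=
  [/\ G (0, 0), forall u v, G u -> G v -> G (u - v)
    & forall d, G (0, d) -> d = 0].

(** The graph [G] enlarged by the multiples of the pair [(b, d)]. *)
Definition adjoin (G : set (A * D)) (b : A) (d : D) : set (A * D) :=
  fun u => exists z : int, G (u.1 - b *~ z, u.2 - d *~ z).

Lemma partial_homM G u (z : int) : partial_hom G -> G u -> G (u *~ z).
Proof.
move=> [G0 GB _] Gu; have GN v : G v -> G (- v) by move=> Gv; rewrite -sub0r;
  exact: GB.
have GM (k : nat) : G (u *+ k).
  elim: k => // k IH; rewrite mulrS -[u in X in X + _]opprK addrC; exact/GB/GN.
by case: z => k; rewrite ?NegzE ?mulrNz; [exact: GM | exact/GN/GM].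
Qed.

Lemma pairMz (x : A) (y : D) (z : int) : (x, y) *~ z = (x *~ z, y *~ z).
Proof.
have nat_case (k : nat) : (x, y) *+ k = (x *+ k, y *+ k).
  by elim: k => // k IH; rewrite !mulrS IH.
case: z => k; first exact: nat_case.
by rewrite NegzE !mulrNz -[(x, y) *~ _]/((x, y) *+ k.+1) nat_case.
Qed.

Lemma partial_hom_adjoin G b d : partial_hom G ->
  (forall z e, G (b *~ z, e) -> e = d *~ z) -> partial_hom (adjoin G b d).
Proof.
move=> [G0 GB Gf] bd; split.
- by exists 0; rewrite !mulr0z !subr0.
- move=> [x y] [x' y'] [z Gz] [z' Gz']; exists (z - z').
  have := GB _ _ Gz Gz'; congr (G _); congr pair => /=;
    by rewrite mulrzBr !opprB addrACA [in RHS]addrACA [X in _ + X = _]addrC.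
- move=> e [z]; rewrite /= sub0r -mulrNz => /bd /eqP.
  by rewrite mulrNz subr_eq addNr => /eqP.
Qed.

(** Divisible groups are injective.  A maximal graph is total: for an element
    [b], the integers z with z b in the domain are the multiples of some n, and
    dividing the value at n b by n gives a value at [b] that is compatible with
    the graph. *)
Lemma partial_hom_extend (G0 : set (A * D)) : partial_hom G0 ->
  exists2 h : A -> D, additive_map h & forall a d, G0 (a, d) -> h a = d.
Proof.
move=> hG0.
(* The empty set must satisfy P, as the union of the empty chain: hence the
   third clause, in place of the inclusion of G0 in G. *)
pose P (G : set (A * D)) := [/\ forall u v, G u -> G v -> G (u - v),
  forall d, G (0, d) -> d = 0 & forall u, G u -> G0 `<=` G].
have [] := @Zorn_bigcup _ P.
  move=> F FP Ftot; split.
  - move=> u v [X FX Xu] [Y FY Yv].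
    have [XY|YX] := Ftot _ _ FX FY.
      by exists Y => //; have [YB _ _] := FP _ FY; apply: YB => //; exact: XY.
    by exists X => //; have [XB _ _] := FP _ FX; apply: XB => //; exact: YX.
  - by move=> d [X FX Xd]; have [_ Xf _] := FP _ FX; exact: Xf.
  - move=> u [X FX Xu] v G0v; exists X => //.
    by have [_ _ X0] := FP _ FX; exact: X0 Xu _ G0v.
move=> G [[GB Gf GG0] Gmax].
have [G00 G0B G0f] := hG0.
have GsubG0 : G0 `<=` G.
  apply: contrapT => nG0; apply: (Gmax G0); last by split=> // u _.
  split=> [u Gu|G0G]; first by case: nG0; exact: GG0 Gu.
  by apply: nG0; apply: GG0 (G0G _ G00).
have hG : partial_hom G by split=> //; exact: GsubG0.
have Gtot b : exists d, G (b, d).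
  have [n nE] : exists n : nat, forall z, (exists d, G (b *~ z, d)) <->
    exists q : int, z = q * n%:Z.
    apply: int_subgroup; first by exists 0; rewrite mulr0z; case: hG.
    by move=> x y [d Gd] [e Ge]; exists (d - e); rewrite mulrzBr;
      exact: GB _ _ Gd Ge.
  have [d0 Gd0] : exists d, G (b *~ n%:Z, d) by apply/(nE n%:Z); exists 1;
    rewrite mul1r.
  have [d dE] : exists d, d *+ n = d0.
    case: n Gd0 {nE} => [|n] Gd0; last exact: D_div.
    by exists 0; rewrite mul0rn; apply/esym/Gf; rewrite -[0](mulr0z b).
  have bd z e : G (b *~ z, e) -> e = d *~ z.
    move=> Ge; have [q zE] : exists q : int, z = q * n%:Z by apply/(nE z);
      exists e.
    have := partial_homM q hG Gd0; rewrite pairMz -mulrzA mulrC -zE => Gz.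
    apply/eqP; rewrite -subr_eq0; apply/eqP/Gf;
      rewrite zE mulrC mulrzA -[d *~ n]/(d *+ n) dE.
    by rewrite -[0](subrr (b *~ z)); exact: GB _ _ Ge Gz.
  have Hadj := partial_hom_adjoin hG bd.
  have Gadj : G `<=` adjoin G b d by move=> [x y] Gxy; exists 0;
    rewrite !mulr0z !subr0.
  exists d; apply: contrapT => nGbd; apply: (Gmax (adjoin G b d)).
    split=> // adjG; apply: nGbd; apply: adjG; exists 1.
    by rewrite /= !mulr1z !subrr; case: hG.
  by case: Hadj => ? ? ?; split=> // u _ v /GsubG0/Gadj.
pose h b := sval (cid (Gtot b)).
have hE b d : G (b, d) -> h b = d.
  rewrite /h; case: cid => e /= Ge Gd; apply/eqP; rewrite -subr_eq0;
    apply/eqP/Gf.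
  by rewrite -[0](subrr b); exact: GB _ _ Ge Gd.
exists h => [x y|a d /GsubG0]; last exact: hE.
apply: hE; apply: (GB (x, h x) (y, h y)); rewrite /h; by case: cid.
Qed.

Hypothesis D_tors : forall n : nat, n != 1%N ->
  exists2 d : D, d != 0 & d *+ n = 0.

(** The multiples of [a] form a cyclic group of order n (infinite when n = 0);
    sending [a] to a nonzero element killed by n is well defined, and extends by
    divisibility. *)
Lemma separating_hom (a : A) : a != 0 ->
  exists2 h : A -> D, additive_map h & h a != 0.
Proof.
move=> a0; pose Z : set (A * D) := fun u => u = (0, 0).
have hZ : partial_hom Z.
  by split=> [//|u v -> ->|d [->] //]; rewrite /Z subrr.
have [n nE] : exists n : nat, forall z, a *~ z = 0 <->
  exists q : int, z = q * n%:Z.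
  by apply: int_subgroup; rewrite ?mulr0z // => x y ax ay;
    rewrite mulrzBr ax ay subrr.
have [d d0 dn] : exists2 d : D, d != 0 & d *+ n = 0.
  apply: D_tors; apply: contra a0 => /eqP n1; apply/eqP; rewrite -[a]mulr1z.
  by apply/nE; exists 1; rewrite n1.
have ad z e : Z (a *~ z, e) -> e = d *~ z.
  by move=> [/nE[q ->] ->]; rewrite mulrC mulrzA -[d *~ n]/(d *+ n) dn mul0rz.
have [h hB hE] := partial_hom_extend (partial_hom_adjoin hZ ad).
exists h => //; rewrite (hE a d) //; exists 1; by rewrite /Z /= !mulr1z !subrr.
Qed.

End HomExtension.

(** * Enough injective modules *)

Section QZ.

Fact integers_closed :
  @GRing.subsemimod_closed int (zmodule rat) (fun x =>
    `[< exists z : int, x = z%:~R >]).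
Proof.
apply: submodule_closed; first by exists 0.
move=> a _ _ [x ->] [y ->]; exists (x * a + y).
by rewrite rmorphD /= rmorphM /= mulrzr.
Qed.

(** The group Q/Z, divisible with elements of every order. *)
Definition QZ : lmodType int := quot_mod (Submodule integers_closed).
Definition QZ_pi : {linear zmodule rat -> QZ} := quot_map _.

Lemma QZ_piMn (q : rat) (n : nat) : QZ_pi q *+ n = QZ_pi (q *+ n).
Proof. by rewrite -(raddfMn QZ_pi). Qed.

Lemma QZ_pi0 q : QZ_pi q = 0 <-> exists z : int, q = z%:~R.
Proof. exact: quot_map0. Qed.

Lemma QZ_div (n : nat) (d : QZ) : (0 < n)%N -> exists d', d' *+ n = d.
Proof.
move=> n0; have [q <-] := quot_map_onto d; exists (QZ_pi ((q : rat) / n%:R)).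
have qn : (q : rat) / n%:R *+ n = q by rewrite -mulr_natr divfK // pnatr_eq0
  -lt0n.
by rewrite QZ_piMn qn.
Qed.

Lemma QZ_inv (n : nat) : (1 < n)%N -> QZ_pi n%:R^-1 != 0.
Proof.
move=> n1; apply/eqP => /QZ_pi0[z zE].
have n0 : (0 : rat) < n%:R by rewrite ltr0n; exact: ltnW.
have z0 : 0 < z by rewrite -(ltr0z rat) -zE invr_gt0.
have : (z%:~R : rat) < 1 by rewrite -zE invf_lt1 // ltr1n.
by rewrite ltrz1 ltNge -gtz0_ge1 z0.
Qed.

Lemma QZ_tors (n : nat) : n != 1%N -> exists2 d : QZ, d != 0 & d *+ n = 0.
Proof.
case: n => [|[//|n]] _; first by exists (QZ_pi 2%:R^-1); rewrite ?mulr0n //;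
  exact: QZ_inv.
exists (QZ_pi n.+2%:R^-1); first exact: QZ_inv.
have nn : (n.+2%:R : rat)^-1 *+ n.+2 = 1 by rewrite -[LHS]mulr_natr mulVf //
  pnatr_eq0.
by rewrite QZ_piMn nn; apply/QZ_pi0; exists 1.
Qed.
End QZ.

Section Coinduced.
Variables (R : pzRingType) (D : lmodType int).

Fact coind_closed :
  subsemimod_closed (fun h : R -> D => `[< {morph h : x y / x - y} >]).
Proof.
apply: submodule_closed => [x y|a f g fB gB x y]; first by rewrite subr0.
by rewrite -[LHS]/(a *: f (x - y) + g (x - y)) fB gB scalerBr opprD addrACA.
Qed.

(** The coinduced module Hom_Z(R, D).  Multiplying the argument on the right
    gives it the structure of a left [R]-module. *)
Definition coind : Type := submod (Submodule coind_closed).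
HB.instance Definition _ := GRing.Zmodule.on coind.
Definition coind_fun (h : coind) : R -> D :=
  submod_in (Submodule coind_closed) h.

Lemma coind_funB h : additive_map (coind_fun h).
Proof.
by have /(submod_inP (Submodule coind_closed))/= : exists y,
  submod_in (Submodule coind_closed) y = coind_fun h by exists h.
Qed.

Lemma coind_inj h h' : coind_fun h =1 coind_fun h' -> h = h'.
Proof.
by move=> /funext hh; exact: (@submod_in_inj _ _ (Submodule coind_closed)
  h h' hh).
Qed.

Lemma coindD h h' x : coind_fun (h + h') x = coind_fun h x + coind_fun h' x.
Proof. by []. Qed.

Lemma coind_mk (h : R -> D) : additive_map h -> exists h', coind_fun h' = h.
Proof. by move=> hB; apply/(submod_inP (Submodule coind_closed)). Qed.

Definition coind_of (h : R -> D) (hB : additive_map h) : coind :=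
  sval (cid (coind_mk hB)).
Lemma coind_ofE h hB x : coind_fun (@coind_of h hB) x = h x.
Proof. by rewrite /coind_of; case: cid => h' /= ->. Qed.

Fact coind_scale_subproof (a : R) (h : coind) : additive_map (fun r =>
    coind_fun h (r * a)).
Proof. by move=> x y; rewrite mulrBl coind_funB. Qed.
Definition coind_scale a h := coind_of (coind_scale_subproof a h).
Lemma coind_scaleE a h r : coind_fun (coind_scale a h) r = coind_fun h (r * a).
Proof. exact: coind_ofE. Qed.

Fact coind_scaleA a b h : coind_scale a (coind_scale b h)
    = coind_scale (a * b) h.
Proof. by apply: coind_inj => r; rewrite !coind_scaleE mulrA. Qed.
Fact coind_scale1 : left_id 1 coind_scale.
Proof. by move=> h; apply: coind_inj => r; rewrite coind_scaleE mulr1. Qed.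
Fact coind_scaleDr : right_distributive coind_scale +%R.
Proof.
by move=> a h h'; apply: coind_inj => r; rewrite coindD !coind_scaleE.
Qed.
Fact coind_scaleDl h : {morph coind_scale^~ h : a b / a + b}.
Proof.
by move=> a b; apply: coind_inj => r; rewrite coindD !coind_scaleE mulrDr
  (additiveD (coind_funB h)).
Qed.
HB.instance Definition _ := GRing.Zmodule_isLmodule.Build R coind
  coind_scaleA coind_scale1 coind_scaleDr coind_scaleDl.

Lemma coindZ a (h : coind) r : coind_fun (a *: h) r = coind_fun h (r * a).
Proof. exact: coind_scaleE. Qed.

(** Linear maps from [B] to Hom_Z(R, D) are the same as additive maps from [B]
    to [D]; the families over [I] take care of products. *)
Lemma coind_hom (I : Type) (B : lmodType R) (phi : I -> B -> D) :
  (forall i, additive_map (phi i)) ->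
  exists g : {linear B -> (I -> coind)}, forall b i r, coind_fun (g b i)
    r = phi i (r *: b).
Proof.
move=> phiB.
have sub b i : additive_map (fun r => phi i (r *: b)).
  by move=> x y; rewrite scalerBl phiB.
pose g b i : coind := coind_of (sub b i).
have g_lin : linear g.
  move=> a x y; apply/funext => i; apply: coind_inj => r.
  by rewrite -[in RHS]/(coind_fun (a *: g x i + g y i) r)
    coindD coindZ !coind_ofE
     scalerDr scalerA (additiveD (phiB i)).
by exists (mk_linear g_lin) => b i r; exact: coind_ofE.
Qed.

Hypothesis D_div : forall (n : nat) (d : D), (0 < n)%N ->
  exists d', d' *+ n = d.

(** A linear map into a product of copies of Hom_Z(R, D) amounts to additive
    maps into [D], which extend because [D] is divisible. *)
Lemma coind_injective (I : Type) (A B : lmodType R) (i : {linear A -> B})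
    (f : {linear A -> (I -> coind)}) : injective i ->
  exists g : {linear B -> (I -> coind)}, forall a, g (i a) = f a.
Proof.
move=> i_inj; pose phi k a := coind_fun (f a k) 1.
have phiB k : additive_map (phi k).
  by move=> x y; rewrite /phi linearB.
have ext k : exists2 h : B -> D, additive_map h & forall a, h (i a) = phi k a.
  pose G : set (B * D) := fun u => exists a, u = (i a, phi k a).
  have hG : partial_hom G.
    split=> [|_ _ [a ->] [a' ->]|d [a []]]; first by exists 0;
      rewrite linear0 (additive0 (phiB k)).
      by exists (a - a'); rewrite linearB phiB.
    by rewrite -(linear0 i) => /i_inj <- ->; exact: additive0.
  have [h hB hE] := partial_hom_extend D_div hG.
  by exists h => // a; apply: hE; exists a.
pose h k := sval (cid2 (ext k)).
have hB k : additive_map (h k) by rewrite /h; case: cid2.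
have hE k a : h k (i a) = phi k a by rewrite /h; case: cid2.
have [g gE] := coind_hom hB; exists g => a.
apply/funext => k; apply: coind_inj => r.
rewrite gE -linearZ hE /phi linearZ.
by rewrite -[LHS]/(coind_fun (r *: f a k) 1) coindZ mul1r.
Qed.
End Coinduced.

(** The additive maps from [M] to Q/Z separate the elements of [M], so together
    they embed [M] into a product of copies of Hom_Z(R, Q/Z).  This product is
    injective: a 1-cocycle on a resolution factors through the image of the
    differential, from where it extends. *)
Lemma FP_inj_embedding (R : pzRingType) (n : nat) (M : lmodType R) :
  exists (E : lmodType R) (i : {linear M -> E}), FP_inj R n E /\ injective i.
Proof.
pose I := {h : M -> QZ | `[< additive_map h >]}.
have IB (k : I) : additive_map (sval k) by case: k => h /= /asboolP.
have [i iE] := coind_hom IB; exists (I -> coind R QZ), i; split; last first.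
  apply: linear_inj => x ix0; apply/eqP; apply: contraT => x0.
  have [h hB /eqP[]] := separating_hom QZ_div QZ_tors x0.
  have := iE x (exist _ h (introT (asboolP _) hB)) 1.
  by rewrite scale1r /= => <-; rewrite ix0.
move=> L _ P [e_onto de dd] _ f fd.
have [e eE] : exists e : {linear aug_obj P 1 -> image_mod (aug_d P 0)},
    forall x, image_in _ (e x) = aug_d P 0 x.
  by apply: corestrict => [|u]; [exact: image_in_inj | apply: (image_inP _
    _).1; exists u].
have [f' f'E] : exists f' : {linear image_mod (aug_d P 0) -> (I -> coind R QZ)},
    forall x, f' (e x) = f x.
  apply: descend => [y|x ex0].
    have [x xE] := (image_inP (aug_d P 0) (image_in _ y)).2 (ex_intro _ y
      erefl).
    by exists x; apply: image_in_inj; rewrite eE.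
  have /(dd 0%N)[u <-] : aug_d P 0 x = 0 by rewrite -eE ex0 linear0.
  exact: fd.
have [g gE] := coind_injective QZ_div f' (@image_in_inj _ _ _ (aug_d P 0)).
by exists g => x; rewrite -eE gE f'E.
Qed.

(** * The two global dimensions *)

Lemma least_le (P : nat -> Prop) m : enat_le (least P) m <->
    exists2 k, (k <= m)%N & P k.
Proof.
rewrite /least; case: pselect => [h|nh] /=; last first.
  by split=> // -[k _ Pk]; apply: nh; exists k; apply/asboolP.
case: ex_minnP => k /asboolP Pk kmin; split=> [km|[j jm Pj]]; first by exists k.
by apply: leq_trans jm; apply: kmin; apply/asboolP.
Qed.

Lemma esup_le (T : Type) (X : T -> Prop) (f : T -> enat) m :
  enat_le (esup X f) m <-> forall x, X x -> enat_le (f x) m.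
Proof.
rewrite least_le; split=> [[k km fk] x Xx|fm]; last by exists m.
have := fk x Xx; case: (f x) => //= j jk; exact: leq_trans jk km.
Qed.

Lemma enat_eq (x y : enat) : (forall m, enat_le x m <-> enat_le y m) -> x = y.
Proof.
case: x y => [x|] [y|] // xy.
- congr Some; apply/eqP; rewrite eqn_leq.
  by rewrite ((xy y).2 (leqnn y)) ((xy x).1 (leqnn x)).
- by case: ((xy x).1 (leqnn x)).
- by case: ((xy y).2 (leqnn y)).
Qed.

Lemma resdim_le (R : pzRingType) (C : lmodType R -> Prop) m M :
  enat_le (resdim C M) m <-> dim_le C m M.
Proof. exact: least_le. Qed.

Lemma global_dim_le (T S : pzRingType) (t : tensor_theory T S) (n m : nat) :
  (forall N, FP_inj T n N -> dim_le (flat (flip t)) m N) ->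
  (forall E, FP_inj S n E -> dim_le (flat t) m E) ->
  forall M, dim_le (GF t (FP_inj T n)) m M.
Proof. exact/GF_dim_of_flat_dim/FP_inj_embedding. Qed.

Theorem corollary3p17 (R : pzRingType) (n : nat)
    (hR : Gorenstein_coherent R n)
    (hfd : lfd_class (FP_inj R n) = rfd_class (FP_inj R^c n)) :
  lwGgl (FP_inj R^c n) = rwGgl (FP_inj R n).
Proof.
have fd_le m : (forall E, FP_inj R n E -> dim_le (@lflat R) m E) <->
    (forall N, FP_inj R^c n N -> dim_le (@rflat R) m N).
  have lE : enat_le (lfd_class (FP_inj R n)) m <->
      forall E, FP_inj R n E -> dim_le (@lflat R) m E.
    by rewrite esup_le; split=> H E /H/resdim_le.
  have rE : enat_le (rfd_class (FP_inj R^c n)) m <->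
      forall N, FP_inj R^c n N -> dim_le (@rflat R) m N.
    by rewrite esup_le; split=> H N /H/resdim_le.
  by rewrite -lE -rE hfd.
have lE m : enat_le (lwGgl (FP_inj R^c n)) m <->
    forall N, FP_inj R^c n N -> dim_le (@rflat R) m N.
  rewrite esup_le; split=> [gl|fdr M _]; last first.
    apply/resdim_le; apply: (@global_dim_le _ _ (std_tensor R)) => //.
    exact/fd_le.
  apply: (@flat_dim_of_GF_dim _ _ (std_tensor R)) => M.
  by apply/resdim_le; exact: gl.
have rE m : enat_le (rwGgl (FP_inj R n)) m <->
    forall E, FP_inj R n E -> dim_le (@lflat R) m E.
  rewrite esup_le; split=> [gl|fdl M _]; last first.
    apply/resdim_le; apply: (@global_dim_le _ _ (flip (std_tensor R))) => //.
    exact/fd_le.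
  apply: (@flat_dim_of_GF_dim _ _ (flip (std_tensor R))) => M.
  by apply/resdim_le; exact: gl.
by apply: enat_eq => m; rewrite lE rE fd_le.
Qed.
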